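(* Let $0\le t\le\lfloor(m-1)/2\rfloor$. The weights of the codewords $c_B$ ($B\ne0$) of the code $C_{symm}(2t+1,m)$ are exactly $$W_{2\ell+1}(2t+1,m)=\frac{q-1}{q}\sum_{r=0}^{2t+1}\mu_r(m)\qquad(0\le\ell,\ 2\ell+1\le m)$$ and $$W_{2\ell}^{\tau}(2t+1,m)=W_1(2t+1,m)-\tau\,\frac{q-1}{q}\,q^{m-\ell+2t}F_t^{(m-2)}(\ell-1)\qquad(1\le\ell,\ 2\ell\le m,\ \tau\in\{1,-1\}).$$
   Context: $m$ is a positive integer, $q$ is a power of an odd prime, $\mathbb{F}_q$ is the finite field with $q$ elements, and $\mathbb{X}$ is the space of $m\times m$ symmetric matrices over $\mathbb{F}_q$. $\mu_r(m)$ is the number of matrices in $\mathbb{X}$ of rank $r$. For $0\le a\le m$ write $\{A\in\mathbb{X}:\operatorname{rank}(A)\le a\}=\{A_1,\dots,A_N\}$; the code $C_{symm}(a,m)\subseteq\mathbb{F}_q^N$ consists of the codewords $c_B=(\mathrm{Tr}(BA_1),\dots,\mathrm{Tr}(BA_N))$, $B\in\mathbb{X}$. Types: a symmetric matrix of odd rank has type $0$. A symmetric matrix of even rank $2s$ has type $1$ (hyperbolic) if the nondegenerate quadratic form it induces modulo its radical is hyperbolic (an orthogonal sum of $s$ hyperbolic planes), and type $-1$ (elliptic) otherwise. Weights: for $B\in\mathbb{X}$ of rank $k$ and type $\tau$, $W_k^{\tau}(a,m)$ denotes the Hamming weight of $c_B\in C_{symm}(a,m)$, i.e. $|\{A\in\mathbb{X}:\operatorname{rank}(A)\le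 a,\ \mathrm{Tr}(BA)\ne0\}|$; it depends only on $k,\tau$ (and $a,m,q$), not on $B$. When $k$ is odd, $\tau$ is omitted. Generalized Krawtchouk polynomials: for an integer $M\ge0$ put $n=\lfloor M/2\rfloor$, and for $0\le s\le n$ let $\Omega_s$ be the set of $M\times M$ skew-symmetric matrices over $\mathbb{F}_q$ of rank $2s$. Fix a nontrivial character $\chi$ of $(\mathbb{F}_q,+)$. For $0\le s\le n$ and any $A=(a_{ij})\in\Omega_s$, $$F_r^{(M)}(s)=\sum_{B=(b_{ij})\in\Omega_r}\chi\Big(\sum_{i<j}a_{ij}b_{ij}\Big),$$ which is independent of the choices of $A$ and $\chi$; $F_r^{(M)}(s)=0$ if $r<0$ or $r>n$. (It is known that for $n\ge1$ and $0\le r\le n$, $F_r^{(M)}(s)=\sum_{j=0}^r(-1)^{r-j}q^{(r-j)(r-j-1)}\left[{n-j\atop n-r}\right]\left[{n-s\atop j}\right]c^j$ with $c=q^{M(M-1)/(2n)}$ and $\left[{a\atop k}\right]=\prod_{i=0}^{k-1}\frac{q^{2a}-q^{2i}}{q^{2k}-q^{2i}}$.) *)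

(* Defs.v *)
From HB Require Import structures.
From mathcomp Require Import all_boot all_order all_algebra.
From mathcomp Require Import all_fingroup all_field all_character.

Set Implicit Arguments.
Unset Strict Implicit.
Unset Printing Implicit Defensive.

Import GRing.Theory Num.Theory.
Local Open Scope ring_scope.

Definition hamming_weight (F : finFieldType) (N : nat) (v : 'rV[F]_N) : nat :=
  #|[set i | v 0 i != 0]|.

Definition symm (F : finFieldType) (m : nat) : {set 'M[F]_m} :=
  [set A | A \is symmetricmx].

Definition mu (F : finFieldType) (r m : nat) : nat :=
  #|[set A in symm F m | \rank A == r]|.

Definition symm_le (F : finFieldType) (a m : nat) : {set 'M[F]_m} :=
  [set A in symm F m | (\rank A <= a)%N].

Definition codeword (F : finFieldType) (a m : nat) (B : 'M[F]_m) :
    'rV[F]_#|symm_le F a m| :=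
  \row_i \tr (B *m enum_val i).

Definition qform (F : finFieldType) (m : nat) (B : 'M[F]_m) (x : 'rV[F]_m) : F :=
  (x *m B *m x^T) 0 0.

(* The radical of qform B is the row space of kermx B, and qform B is constant
   on its cosets. When \rank B = 2s, the condition on (U + V + kermx B) says that
   the classes of the 2s rows u_i of U and v_i of V form a basis of the quotient
   by the radical. In that basis the induced form is \sum_i x_i y_i, the
   orthogonal sum of the s hyperbolic planes <u_i, v_i>. *)
Definition hyperbolic (F : finFieldType) (m : nat) (B : 'M[F]_m) : bool :=
  let s := (\rank B)./2 in
  [exists U : 'M[F]_(s, m), exists V : 'M[F]_(s, m),
    row_full (U + V + kermx B)%MS &&
    [forall x : 'rV[F]_s, forall y : 'rV[F]_s,
      qform B (x *m U + y *m V) == \sum_i x 0 i * y 0 i]].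

Definition symm_type (F : finFieldType) (m : nat) (B : 'M[F]_m) : int :=
  if odd (\rank B) then 0 else if hyperbolic B then 1 else -1.

Definition symm_class (F : finFieldType) (m k : nat) (tau : int) : {set 'M[F]_m} :=
  [set B in symm F m | (\rank B == k) && (symm_type B == tau)].

(* The weight of c_B for a representative B of the class; the value 0 for an
   empty class is a dummy. *)
Definition class_weight (F : finFieldType) (a m k : nat) (tau : int) : nat :=
  if [pick B in symm_class F m k tau] is Some B
  then hamming_weight (codeword a B) else 0%N.

Definition Omega (F : finFieldType) (M s : nat) : {set 'M[F]_M} :=
  [set A | (A \is skewmx) && (\rank A == s.*2)].

(* krawtchouk chi r A is the value F_r^(M)(s) computed from the representative
   A in Omega F M s and the additive character chi. *)
Definition krawtchouk (F : finFieldType) (chi : 'CF([set: F])) (M r : nat)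
    (A : 'M[F]_M) : algC :=
  \sum_(B in Omega F M r)
    chi (\sum_(i < M) \sum_(j < M | (i < j)%N) A i j * B i j).

(* Main.v *)
Require Import Defs.
From HB Require Import structures.
From mathcomp Require Import all_boot all_order all_algebra.
From mathcomp Require Import all_fingroup all_solvable all_field all_character.
From mathcomp Require Import ring zify.

(** The Hamming weight of a codeword is read off from character sums: summing
    chi over the multiples of the value at A detects whether this value vanishes,
    so that q times the weight of c_B is (q - 1) N minus the sum, over the nonzero
    scalars c, of S(cB), where S(B) is the sum of chi (tr (BA)) over the symmetric
    A of rank at most 2t + 1, and N is the number of these A.  Everything follows
    from two facts about S(B), for B symmetric of size m:

    - S(B) = 0 if B has odd rank (cumsum_odd_rank);
    - S(B) = G(B) R(C) if B has even rank 2l, where G(B) is the quadratic Gauss sum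
      over all u of chi (u B u^T), C is any skew-symmetric matrix of rank 2l, and
      R(C) is the sum of chi (tr (C^T D)) over the skew-symmetric D of rank at most
      2t (cumsum_symm_skew).

    Both S and R are handled by one computation.  Write a matrix with A^T = eps A,
    eps = 1 or -1, as a border (y, v) around a smaller one A'.  Its rank is the
    rank of A' plus 2 when v is outside the row space of A', and otherwise plus 0
    or 1, according to whether y is the value forced by v (rank_border).  Hence a
    sum over bordered matrices of bounded rank splits according to the rank of A'
    (sum_border_rank), and only the two top ranks of A' survive when the sum over
    all borders vanishes.  Adding a hyperbolic plane H to the argument therefore
    gives, for k even, the two parallel recursions

      S_(k+2)(H + B) = q^(k+1) (S_(k+2)(B) - S_k(B)),
      R_(k+2)(H + C) = q^k     (R_(k+2)(C) - R_k(C)),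

    the index bounding the rank strictly from above.  The Gauss sum obeys
    G(H + B) = q G(B), so the relation S = G R is inherited by orthogonal sums with
    planes, and its base case, the count S_k(0) = q^m R_k(0) of matrices of bounded
    rank, comes from the same bordering recursion.

    A general B of rank at least 2 is congruent to diag(b, b') + B''.  Multiplying
    b by a nonzero c multiplies both G and S_k, k even, by the quadratic character
    of c, because only Gauss sums of forms of odd rank k - 1 occur when b is
    peeled off (cumsum_diag).  With c = - b' / b the plane becomes hyperbolic,
    which reduces B to a smaller matrix (plane_reduction); rank 1 vanishes because
    rescaling A by a nonsquare changes the sign of the sum (cumsum_rank1).

    Finally, G(B) = tau q^(m - l) where tau is the type of B (gsum_symm_type), and
    R at the sum of a plane and A, of size m, is q^(2t) times the Krawtchouk value
    at A, of size m - 2, which is the exponent m - l + 2t of the theorem. *)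

Set Implicit Arguments.
Unset Strict Implicit.
Unset Printing Implicit Defensive.
Import Order.TTheory GRing.Theory Num.Theory.
Local Open Scope ring_scope.

(** * Generalities *)

(** Symmetric (eps = 1) and skew-symmetric (eps = -1) matrices are treated
    together: the two families satisfy the same bordering rule, with different
    sets of admissible corner entries. *)
Definition sesq (F : finFieldType) (eps : F) (m : nat) : pred 'M[F]_m :=
  fun A => A^T == eps *: A.

Definition border (F : finFieldType) (eps : F) (n : nat) (y : F) (v : 'rV[F]_n)
    (A : 'M[F]_n) : 'M[F]_(1 + n) :=
  block_mx y%:M v (eps *: v^T) A.

(** Orthogonal sum of a hyperbolic plane and B.  With the off-diagonal entry 1/2
    the symmetric plane is the quadratic form x y, and the trace pairing with C
    contributes exactly the corresponding off-diagonal entry of C. *)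
Definition hplus (F : finFieldType) (eps : F) (n : nat) (B : 'M[F]_n) :
    'M[F]_(1 + (1 + n)) :=
  border eps 0 (row_mx (2%:R^-1)%:M 0) (border eps 0 0 B).

(** The form induced by A on its row space, u A |-> u A u^T; see row_space_formE.
    A row v and its transpose can border A without raising the rank exactly when
    the corner entry is this value at v. *)
Definition row_space_form (F : finFieldType) (m : nat) (A : 'M[F]_m) (v : 'rV[F]_m) : F :=
  (v *m (v *m pinvmx A)^T) 0 0.

(** Translation by v0 multiplies the sum by phi v0, which is not 1. *)
Lemma sum_nontrivial_char (V : finZmodType) (phi : V -> algC) v0 :
  {morph phi : u v / u + v >-> u * v} -> phi v0 != 1 -> \sum_v phi v = 0.
Proof.
move=> phiD v0N; have : \sum_v phi v = phi v0 * \sum_v phi v.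
  rewrite mulr_sumr (reindex_inj (addrI v0)) /=.
  by apply: eq_bigr => v _; rewrite phiD.
move/eqP; rewrite -subr_eq0 -[X in X - _]mul1r -mulrBl mulf_eq0 subr_eq0.
by rewrite eq_sym (negPf v0N) /= => /eqP.
Qed.

Lemma card_row_kernel (F : finFieldType) p n (A : 'M[F]_(p, n)) :
  #|[pred u : 'rV_p | u *m A == 0]| = (#|F| ^ (p - \rank A))%N.
Proof.
rewrite -mxrank_ker -card_rowg; apply: eq_card => u.
by rewrite !inE; apply/eqP/sub_kermxP.
Qed.

Lemma sum_row_space (F : finFieldType) p n (A : 'M[F]_(p, n)) (f : 'rV_n -> algC) :
  \sum_u f (u *m A) = #|F|%:R ^+ (p - \rank A) * \sum_(v | (v <= A)%MS) f v.
Proof.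
rewrite (partition_big (fun u => u *m A) (fun v => (v <= A)%MS)) => [|u _]; last first.
  exact: submxMl.
rewrite mulr_sumr; apply: eq_bigr => v /submxP[w ->].
rewrite (eq_bigr (fun _ => f (w *m A))) => [|u /eqP-> //].
rewrite sumr_const -[LHS]mulr_natl -natrX -(card_row_kernel A); congr (_%:R * _).
transitivity #|[pred u : 'rV_p | u *m A == w *m A]|; first exact: eq_card.
rewrite -!sum1_card [LHS](reindex_inj (addIr w)) /=; apply: eq_bigl => u.
by rewrite !inE mulmxDl -subr_eq0 addrK.
Qed.

Lemma q_neq0 (F : finFieldType) : #|F|%:R != 0 :> algC.
Proof. by rewrite pnatr_eq0 -lt0n; apply/card_gt0P; exists 0. Qed.

Lemma card_sqrt (F : finFieldType) (y : F) : (#|[pred x : F | x ^+ 2 == y]| <= 2)%N.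
Proof.
have [[s /eqP <-]|no] := altP (@existsP _ (fun x : F => x ^+ 2 == y)).
  rewrite (leq_trans (subset_leq_card (_ : _ \subset [:: s; - s]))) ?card_size //.
  by apply/subsetP => x; rewrite !inE -eqf_sqr.
rewrite eq_card0 // => x; rewrite !inE; apply: contraNF no => xy.
by apply/existsP; exists x.
Qed.

Lemma sum_eq_bounded (I : finType) (f g : I -> nat) :
  (forall i, f i <= g i)%N -> (\sum_i f i = \sum_i g i)%N -> forall i, f i = g i.
Proof.
move=> le E; have /leqif_sum h : forall i : I, true -> (f i <= g i ?= iff (f i == g i))%N.
  by move=> i _; split; rewrite ?le.
have [_] := h; rewrite E eqxx => /esym/forallP a i; exact/eqP/a.
Qed.

(** * Bordered matrices and congruence *)

Section OddField.
Variable F : finFieldType.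
Hypothesis two_neq0 : 2%:R != 0 :> F.
Let one2 : 1 * 1 = 1 :> F := mulr1 1.
Let mone2 : (-1) * (-1) = 1 :> F.
Proof. by rewrite mulrNN mulr1. Qed.

Section Forms.
Variable eps : F.
Hypothesis eps2 : eps * eps = 1.

Lemma row_space_formE m (A : 'M[F]_m) u :
  sesq eps A -> row_space_form A (u *m A) = qform A u.
Proof.
move=> /eqP sA; rewrite /row_space_form /qform; set x := _ *m pinvmx A.
have xA : x *m A = u *m A by rewrite mulmxKpV ?submxMl.
have xAt : A^T *m x^T = A^T *m u^T by rewrite -!trmx_mul xA.
have At : A = eps *: A^T by rewrite sA scalerA eps2 scale1r.
suff -> : u *m A *m x^T = u *m A *m u^T by [].
by rewrite -!mulmxA; congr (u *m _); rewrite At -!scalemxAl xAt.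
Qed.

Lemma qform_eps m (A : 'M[F]_m) u : sesq eps A -> eps * qform A u = qform A u.
Proof.
move=> /eqP sA; have : u *m A^T *m u^T = (u *m A *m u^T)^T.
  by rewrite !trmx_mul trmxK mulmxA.
rewrite sA -scalemxAr -scalemxAl => /matrixP/(_ 0 0).
by rewrite [LHS]mxE [RHS]mxE.
Qed.

Lemma rank_add_row p n (v : 'rV[F]_n) (A : 'M[F]_(p, n)) :
  \rank (col_mx v A) = (\rank A + ~~ (v <= A)%MS)%N.
Proof.
rewrite -addsmxE; case vA: (v <= A)%MS; rewrite ?addn0.
  by rewrite (addsmx_idPr vA).
have v0 : v != 0 by apply: contraFneq vA => ->; rewrite sub0mx.
have cap0 : (v :&: A)%MS = 0.
  apply/eqP; rewrite -mxrank_eq0; apply: contraFT vA => nz.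
  have r1 : (\rank (v :&: A) == \rank v)%N.
    rewrite eqn_leq mxrankS ?capmxSl //= rank_rV v0 lt0n.
    exact: nz.
  by move: r1; rewrite (mxrank_leqif_sup (capmxSl v A)) sub_capmx => /andP[].
by rewrite addsmxC mxrank_disjoint_sum 1?capmxC // rank_rV v0.
Qed.

Lemma sub_trmx_sesq m (A : 'M[F]_m) (v : 'rV[F]_m) :
  sesq eps A -> ((eps *: v^T)^T <= A^T)%MS = (v <= A)%MS.
Proof.
move=> /eqP ->; have e0 : eps != 0.
  by apply: contra_eqN eps2 => /eqP ->; rewrite mul0r eq_sym oner_eq0.
by rewrite linearZ /= trmxK !eqmx_scale.
Qed.

Lemma rank_row_mx n (A : 'M[F]_n) (w : 'cV[F]_n) :
  \rank (row_mx w A) = (\rank A + ~~ (w^T <= A^T)%MS)%N.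
Proof. by rewrite -mxrank_tr tr_row_mx rank_add_row mxrank_tr. Qed.

(** Clearing the border by a shear leaves the Schur complement y - u A u^T. *)
Lemma border_cong n y u (A : 'M[F]_n) : sesq eps A ->
  border eps y (u *m A) A =
  block_mx 1%:M u 0 1%:M *m block_mx (y - qform A u)%:M 0 0 A
    *m (block_mx 1%:M u 0 1%:M)^T.
Proof.
move=> /eqP sA; rewrite /border tr_block_mx !mulmx_block !trmx1 trmx0.
rewrite !mul1mx !mul0mx !mulmx1 !mulmx0.
rewrite !addr0 !add0r trmx_mul sA -scalemxAl scalerA eps2 scale1r /border.
congr block_mx.
by rewrite [u *m A *m _]mx11_scalar -/(qform A u) -raddfD subrK.
Qed.

Lemma unit_shear n (u : 'rV[F]_n) :
  (block_mx 1%:M u 0 1%:M : 'M_(1 + n)) \in unitmx.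
Proof. by rewrite unitmxE det_ublock !det1 mulr1 unitr1. Qed.

Lemma rank_cong m (P A : 'M[F]_m) : P \in unitmx ->
  \rank (P *m A *m P^T) = \rank A.
Proof.
move=> uP; rewrite mxrankMfree ?row_free_unit ?unitmx_tr //.
by rewrite (eqmxMfull A) // row_full_unit.
Qed.

(** The source of all the recursions.  If v lies in the row space of A, shearing
    reduces to a diagonal block; otherwise the new column and the new row are each
    independent of what is already there. *)
Lemma rank_border n y v (A : 'M[F]_n) : sesq eps A ->
  \rank (border eps y v A) =
  (\rank A + (if (v <= A)%MS then (y != row_space_form A v) : nat else 2))%N.
Proof.
move=> sA; case: ifPn => [/submxP[u ->]|vA].
  rewrite row_space_formE // border_cong // rank_cong ?unit_shear //.
  rewrite rank_diag_block_mx addnC rank_rV; congr (_ + nat_of_bool _)%N.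
  rewrite -(subr_eq0 y); congr negb; apply/eqP/eqP => [/matrixP/(_ 0 0)|->].
    by rewrite !mxE mulr1n.
  by apply/matrixP=> i j; rewrite !mxE mul0rn.
rewrite /border block_mxEv rank_add_row rank_row_mx sub_trmx_sesq // vA.
case: (boolP (row_mx _ _ <= _)%MS); last by rewrite -addnA.
move=> /(submxMr (col_mx 0 1%:M)); rewrite !mul_row_col !mulmx0 !add0r !mulmx1.
by rewrite (negPf vA).
Qed.

Lemma sesq_border n y v (A : 'M[F]_n) :
  sesq eps (border eps y v A) = (y == eps * y) && sesq eps A.
Proof.
rewrite /sesq /border tr_block_mx scale_block_mx tr_scalar_mx linearZ /= trmxK.
rewrite scale_scalar_mx scalerA eps2 scale1r; apply/eqP/andP.
  move=> /eq_block_mx[/matrixP/(_ 0 0)]; rewrite !mxE !mulr1n => {1}-> _ _ ->.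
  by rewrite !eqxx.
by move=> [/eqP {1}-> /eqP ->].
Qed.

Lemma border_submx n (C : 'M[F]_(1 + n)) :
  sesq eps C -> C = border eps (C 0 0) (ursubmx C) (drsubmx C).
Proof.
move=> sC; rewrite -[LHS]submxK /border; congr block_mx.
  apply/matrixP=> i j; rewrite !ord1 !mxE mulr1n; congr (C _ _); exact/val_inj.
apply/esym; rewrite trmx_ursub (eqP sC); apply/matrixP=> i j.
by rewrite !mxE mulrA eps2 mul1r.
Qed.

Lemma border00 n y v (A : 'M[F]_n) : border eps y v A 0 0 = y.
Proof.
have -> : 0 = lshift n 0 :> 'I_(1 + n) by apply/val_inj.
by rewrite block_mxEul mxE eqxx mulr1n.
Qed.

(** A subspace on which the form is nondegenerate splits off: the rows orthogonal
    to U form a space of dimension n which meets the row space of U in zero. *)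
Lemma orthogonal_complement k n (B : 'M[F]_(k + n)) (U : 'M[F]_(k, k + n)) :
  U *m B *m U^T \in unitmx ->
  exists2 W : 'M[F]_(n, k + n), W *m B *m U^T = 0 & col_mx U W \in unitmx.
Proof.
move=> uG; set G := U *m B *m U^T in uG.
have rk : \rank (B *m U^T) = k.
  apply/eqP; rewrite eqn_leq rank_leq_col /=.
  by rewrite -{1}(mxrank_unit uG) /G -mulmxA mxrankM_maxr.
have rK : \rank (kermx (B *m U^T)) = n by rewrite mxrank_ker rk addKn.
move: (row_base_free (kermx (B *m U^T))) (eq_row_base (kermx (B *m U^T))).
move: (row_base _); rewrite rK => W fW eW; exists W.
  by rewrite -mulmxA; apply/sub_kermxP; rewrite eW.
have WBU : W *m (B *m U^T) = 0 by apply/sub_kermxP; rewrite eW.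
rewrite -row_free_unit -kermx_eq0; apply/eqP/row_matrixP => i; rewrite row0.
move: (row_sub i (kermx (col_mx U W))); set z := row _ _ => /sub_kermxP zUW.
have := zUW; rewrite -[z]hsubmxK mul_row_col => zE.
have := congr1 (mulmx^~ (B *m U^T)) zE; rewrite mulmxDl mul0mx -[_ *m W *m _]mulmxA.
rewrite WBU mulmx0 addr0 -mulmxA [U *m _]mulmxA -/G => z1.
have l0 : lsubmx z = 0.
  by rewrite -[lsubmx z](mulmxK uG) z1 mul0mx.
have : rsubmx z *m W = 0 by move: zE; rewrite l0 mul0mx add0r.
rewrite -[X in _ = X -> _](mul0mx _ W) => /(row_free_inj fW) ->.
by rewrite l0 row_mx0.
Qed.

Lemma sesq_cong m p (P : 'M[F]_(p, m)) A : sesq eps A -> sesq eps (P *m A *m P^T).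
Proof.
move=> /eqP sA; rewrite /sesq !trmx_mul trmxK sA.
by rewrite -scalemxAl -scalemxAr mulmxA.
Qed.

Lemma sesq_swap m p r (B : 'M[F]_m) (X : 'M[F]_(p, m)) (Y : 'M[F]_(r, m)) :
  sesq eps B -> X *m B *m Y^T = eps *: (Y *m B *m X^T)^T.
Proof.
move=> /eqP sB; rewrite !trmx_mul trmxK sB -scalemxAl -scalemxAr scalerA eps2.
by rewrite scale1r mulmxA.
Qed.

(** An isotropic x outside the radical pairs to 1/2 with some y, and
    subtracting (qform B y) x from y makes y isotropic as well. *)
Lemma hyperbolic_pair m (B : 'M[F]_m) x :
  sesq eps B -> qform B x = 0 -> x *m B != 0 ->
  exists2 y, (x *m B *m y^T) 0 0 = 2%:R^-1 & qform B y = 0.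
Proof.
move=> sB qx xB; have [j xBj] : exists j, (x *m B) 0 j != 0.
  apply/existsP; apply: contraNT xB; rewrite negb_exists => /forallP h.
  by apply/eqP/rowP=> j; rewrite [RHS]mxE; apply/eqP; rewrite -[_ == _]negbK.
pose y := (2%:R * (x *m B) 0 j)^-1 *: delta_mx 0 j : 'rV[F]_m.
have xy : (x *m B *m y^T) 0 0 = 2%:R^-1.
  rewrite {}/y; move: (x *m B) xBj => z zj.
  rewrite linearZ /= trmx_delta -scalemxAr mxE -colE mxE invfM divfK //.
have yx : (y *m B *m x^T) 0 0 = eps * 2%:R^-1.
  by rewrite (sesq_swap y x sB) mxE [_^T 0 0]mxE xy.
have Bz (M N : 'M[F]_1) : (M - N) 0 0 = M 0 0 - N 0 0 by rewrite !mxE.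
have Zz c (M : 'M[F]_1) : (c *: M) 0 0 = c * M 0 0 by rewrite mxE.
clearbody y; exists (y - qform B y *: x).
  rewrite linearB linearZ /= mulmxBr -scalemxAr Bz Zz xy.
  by rewrite -/(qform B x) qx mulr0 subr0.
rewrite [qform B (y - _)]/qform [(y - _)^T]linearB /= [(_ *: x)^T]linearZ /=.
rewrite mulmxBr !mulmxBl -!scalemxAl -!scalemxAr.
rewrite !(Bz, Zz) xy yx -/(qform B x) qx -/(qform B y).
have := qform_eps y sB; set q := qform B y => qe.
rewrite !mulr0 subr0.
suff -> : q * (eps * 2%:R^-1) = q * 2%:R^-1 by field.
by rewrite mulrA [q * _]mulrC qe.
Qed.

Definition hplane : 'M[F]_(1 + 1) :=
  block_mx 0 (2%:R^-1)%:M (eps *: (2%:R^-1)%:M) 0.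

Lemma hplane_unit : hplane \in unitmx.
Proof.
suff /mulmx1_unit[] : hplane *m
  (block_mx 0 (eps *: 2%:R%:M) (2%:R%:M) 0 : 'M_(1 + 1)) = 1%:M by [].
rewrite mulmx_block !mulmx0 !mul0mx !add0r !addr0 -!scalemxAl -!scalemxAr.
by rewrite scalerA eps2 scale1r -!scalar_mxM mulVf // -scalar_mx_block.
Qed.

Lemma hyperbolic_pair_gram m (B : 'M[F]_m) x y :
  sesq eps B -> qform B x = 0 -> qform B y = 0 ->
  (x *m B *m y^T) 0 0 = 2%:R^-1 ->
  (col_mx x y) *m B *m (col_mx x y)^T = hplane.
Proof.
move=> sB qx qy xy; rewrite tr_col_mx !mul_col_mx !mul_mx_row -block_mxEv.
rewrite (sesq_swap y x sB).
rewrite [x *m B *m x^T]mx11_scalar -/(qform B x) qx.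
rewrite [y *m B *m y^T]mx11_scalar -/(qform B y) qy.
by rewrite [x *m B *m y^T]mx11_scalar xy tr_scalar_mx raddf0.
Qed.

(** The Gram matrix of the hyperbolic pair is invertible of size 2, so the
    ambient space has dimension at least 2. *)
Lemma isotropic_dim m (B : 'M[F]_m) x :
  sesq eps B -> qform B x = 0 -> x *m B != 0 -> (1 < m)%N.
Proof.
move=> sB qx xB; have [y xy qy] := hyperbolic_pair sB qx xB.
have := hyperbolic_pair_gram sB qx qy xy.
move/(congr1 mxrank); rewrite (mxrank_unit hplane_unit) => r2.
apply: leq_trans (rank_leq_col (col_mx x y)).
by rewrite -[X in (X <= _)%N]r2 -mulmxA mxrankM_maxl.
Qed.

Lemma isotropic_split n (B : 'M[F]_(1 + (1 + n))) x :
  sesq eps B -> qform B x = 0 -> x *m B != 0 ->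
  exists P : 'M[F]_(1 + (1 + n)), exists B' : 'M[F]_n,
    [/\ P \in unitmx, sesq eps B' & P *m B *m P^T = hplus eps B'].
Proof.
move=> sB qx xB; have [y xy qy] := hyperbolic_pair sB qx xB.
have G := hyperbolic_pair_gram sB qx qy xy.
have uG := hplane_unit; rewrite -G in uG.
have [W WB uP] := @orthogonal_complement (1 + 1) n B _ uG.
exists (col_mx x (col_mx y W)), (W *m B *m W^T); split.
- by rewrite col_mxA castmx_id.
- exact: sesq_cong.
have [Wx Wy] : W *m B *m x^T = 0 /\ W *m B *m y^T = 0.
  by apply: eq_row_mx; rewrite row_mx0 -mul_mx_row -tr_col_mx.
rewrite !tr_col_mx !mul_col_mx !mul_mx_row /hplus /border block_mxEv.
rewrite (sesq_swap y x sB).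
rewrite (sesq_swap x W sB) (sesq_swap y W sB) Wx Wy trmx0 scaler0.
rewrite [x *m B *m x^T]mx11_scalar -/(qform B x) qx.
rewrite [y *m B *m y^T]mx11_scalar -/(qform B y) qy.
rewrite [x *m B *m y^T]mx11_scalar xy.
congr col_mx; rewrite block_mxEv tr_row_mx trmx0 scale_col_mx scaler0.
by rewrite tr_scalar_mx raddf0 -block_mxEv -block_mxEh.
Qed.

Lemma border0_rank n y (A : 'M[F]_n) : sesq eps A ->
  \rank (border eps y 0 A) = ((y != 0)%R + \rank A)%N.
Proof.
move=> sA; rewrite rank_border // sub0mx addnC.
by rewrite /row_space_form !mul0mx [(0 : 'M_1) 0 0]mxE.
Qed.

Lemma sesq_border0 n (A : 'M[F]_n) : sesq eps A -> sesq eps (border eps 0 0 A).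
Proof. by move=> sA; rewrite sesq_border mulr0 eqxx. Qed.

Lemma sesq_hplus n (A : 'M[F]_n) : sesq eps A -> sesq eps (hplus eps A).
Proof. by move=> sA; rewrite sesq_border mulr0 eqxx sesq_border0. Qed.

Lemma rank_hplus n (A : 'M[F]_n) : sesq eps A ->
  \rank (hplus eps A) = (\rank A).+2.
Proof.
move=> sA; rewrite rank_border ?sesq_border0 // border0_rank // eqxx add0n.
case: ifPn => [|_]; last by rewrite addn2.
move/submxP=> [u]; rewrite /border trmx0 scaler0 -[u]hsubmxK mul_row_block.
rewrite raddf0 !mulmx0 addr0 => /eq_row_mx[/matrixP/(_ 0 0)].
by rewrite !mxE mulr1n => /eqP; rewrite invr_eq0 (negPf two_neq0).
Qed.

Lemma sesq0 m : sesq eps (0 : 'M[F]_m).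
Proof. by rewrite /sesq trmx0 scaler0. Qed.

Lemma hplus_mul n (x y : F) (z : 'rV[F]_n) (B : 'M[F]_n) :
  row_mx x%:M (row_mx y%:M z) *m hplus eps B =
  row_mx ((eps * 2%:R^-1 * y)%:M) (row_mx ((2%:R^-1 * x)%:M) (z *m B)).
Proof.
rewrite /hplus /border tr_row_mx !trmx0 scale_col_mx !scaler0 mul_row_block.
rewrite mul_row_col mul_mx_row mul_row_block tr_scalar_mx scale_scalar_mx.
rewrite -!scalar_mxM !mulr0 raddf0 !(mulmx0, add0r, addr0) add_row_mx.
by rewrite !(mulmx0, add0r, addr0) mulrC [x * _]mulrC.
Qed.

End Forms.

Lemma qform_row1 n b (A : 'M[F]_n) (x : F) u :
  qform (border 1 b 0 A) (row_mx x%:M u) = b * x ^+ 2 + qform A u.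
Proof.
rewrite /qform /border trmx0 scaler0 mul_row_block tr_row_mx mul_row_col.
rewrite !mulmx0 addr0 add0r tr_scalar_mx -!scalar_mxM !mxE eqxx mulr1n.
by rewrite mulrAC [b * _]mulrC mulrC expr2 mulrA.
Qed.

(** Polarization, which needs 2 to be invertible. *)
Lemma symmetric_neq0 m (B : 'M[F]_m) : sesq 1 B -> B != 0 ->
  exists x, qform B x != 0.
Proof.
move=> sB B0; pose e i : 'rV[F]_m := delta_mx 0 i.
suff /existsP[i /existsP[j q0]] : [exists i, exists j, qform B (e i + e j) != 0].
  by exists (e i + e j).
have Dz (M N : 'M[F]_1) : (M + N) 0 0 = M 0 0 + N 0 0 by rewrite !mxE.
have E k l : (e k *m B *m (e l)^T) 0 0 = B k l.
  by rewrite trmx_delta -rowE -colE !mxE.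
have Q i j : qform B (e i + e j) = B i i + B j j + 2%:R * B i j.
  rewrite /qform raddfD /= mulmxDr !mulmxDl !Dz !E.
  have -> : B j i = B i j by have /eqP/matrixP/(_ i j) := sB; rewrite !mxE mul1r.
  by ring.
apply: contraNT B0; rewrite negb_exists => /forallP h.
have {}h i j : B i i + B j j + 2%:R * B i j = 0.
  by have := h i; rewrite negb_exists => /forallP/(_ j); rewrite negbK Q => /eqP.
have Bii i : B i i = 0.
  have /eqP := h i i; have -> : B i i + B i i + 2 * B i i = 2 * (2 * B i i) by ring.
  by rewrite !mulf_eq0 (negPf two_neq0) => /eqP.
apply/eqP/matrixP => i j; have /eqP := h i j; rewrite !Bii !add0r mxE.
by rewrite mulf_eq0 (negPf two_neq0) => /eqP.
Qed.

Lemma diagonal_split n (B : 'M[F]_(1 + n)) : sesq 1 B -> B != 0 ->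
  exists P : 'M[F]_(1 + n), exists b, exists B' : 'M[F]_n,
    [/\ P \in unitmx, b != 0, sesq 1 B' & P *m B *m P^T = border 1 b 0 B'].
Proof.
move=> sB B0; have [x qx] := symmetric_neq0 sB B0.
have G : x *m B *m x^T = (qform B x)%:M by rewrite [LHS]mx11_scalar.
have uG : x *m B *m x^T \in unitmx.
  by rewrite G unitmxE det_scalar1 unitfE.
have [W WB uP] := orthogonal_complement uG.
exists (col_mx x W), (qform B x), (W *m B *m W^T); split=> //.
  by apply: sesq_cong.
rewrite tr_col_mx !mul_col_mx !mul_mx_row G WB (sesq_swap one2 x W sB) WB.
by rewrite trmx0 scaler0 /border block_mxEv trmx0 scaler0.
Qed.

Lemma border0_cong n b (P A : 'M[F]_n) :
  (block_mx 1%:M 0 0 P : 'M_(1 + n)) *m border 1 b 0 A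
    *m (block_mx 1%:M 0 0 P)^T = border 1 b 0 (P *m A *m P^T).
Proof.
rewrite /border trmx0 scaler0 tr_block_mx !mulmx_block !trmx0 trmx1.
by rewrite !(mul0mx, mulmx0, mul1mx, mulmx1, addr0, add0r).
Qed.

Lemma unit_diag1 n (P : 'M[F]_n) :
  P \in unitmx -> (block_mx 1%:M 0 0 P : 'M_(1 + n)) \in unitmx.
Proof. by rewrite !unitmxE det_ublock det1 mul1r. Qed.

Lemma skew_qform m (A : 'M[F]_m) x :
  sesq (-1) A -> qform A x = 0.
Proof.
move=> sA; have := qform_eps x sA; rewrite mulN1r => /eqP.
rewrite eq_sym -addr_eq0 -mulr2n -mulr_natr mulf_eq0 (negPf two_neq0) orbF.
by move/eqP.
Qed.

Lemma neq0_row m (A : 'M[F]_m) : A != 0 -> exists x : 'rV_m, x *m A != 0.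
Proof.
move=> A0; suff /existsP[i ri] : [exists i, row i A != 0].
  by exists (delta_mx 0 i); rewrite -rowE.
apply: contraNT A0; rewrite negb_exists => /forallP h; apply/eqP/row_matrixP=> i.
by rewrite row0; apply/eqP; rewrite -[_ == _]negbK.
Qed.

(** Every vector is isotropic for a skew form, so planes split off until nothing
    is left. *)
Lemma skew_rank_even m (A : 'M[F]_m) : sesq (-1) A -> ~~ odd (\rank A).
Proof.
elim/ltn_ind: m A => m IH A sA; have [->|A0] := eqVneq A 0.
  by rewrite mxrank0.
have [x xA] := neq0_row A0; have qx := skew_qform x sA.
have := isotropic_dim mone2 sA qx xA.
case: m IH A sA A0 x xA qx => [|[|n]] // IH A sA A0 x xA qx _.
have [P [B' [uP sB' PE]]] := @isotropic_split _ mone2 n A x sA qx xA.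
have := rank_cong A uP; rewrite PE rank_hplus // => <-.
by rewrite /= negbK; apply: IH.
Qed.

(** * Character sums over matrices of bounded rank *)

Section Characters.
Variable chi : F -> algC.
Hypothesis chi0 : chi 0 = 1.
Hypothesis chiD : {morph chi : x y / x + y >-> x * y}.
Hypothesis chiN1 : exists x, chi x != 1.
Local Notation q := (#|F|%:R : algC).

Lemma sum_chi_scale b : b != 0 -> \sum_x chi (b * x) = 0.
Proof.
move=> b0; have [x0 x0N] := chiN1.
apply: (@sum_nontrivial_char _ _ (b^-1 * x0)) => [x y|]; rewrite ?mulrDr ?chiD //.
by rewrite mulVKf.
Qed.

Lemma sum_chi_dot n (c : 'cV[F]_n) :
  \sum_(u : 'rV_n) chi ((u *m c) 0 0) = (c == 0)%:R * q ^+ n.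
Proof.
have [->|c0] := eqVneq c 0.
  rewrite (eq_bigr (fun _ => 1)) => [|u _]; last by rewrite mulmx0 mxE.
  by rewrite sumr_const card_mx mul1n mul1r natrX.
have [i ci] : exists i, c i 0 != 0.
  apply/existsP; apply: contraNT c0; rewrite negb_exists => /forallP h.
  by apply/eqP/colP=> i; rewrite mxE; apply/eqP; rewrite -[_ == _]negbK.
have [x0 x0N] := chiN1; rewrite mul0r.
apply: (@sum_nontrivial_char _ _ ((x0 / c i 0) *: delta_mx 0 i)) => [u v|].
  by rewrite mulmxDl mxE chiD.
by rewrite -scalemxAl -rowE mxE [row _ _ _ _]mxE divfK.
Qed.

(** The rank is bounded strictly so that, for the even k which matter here,
    k = 2t + 2 reads rank at most 2t + 1 for symmetric matrices and rank at most
    2t for skew-symmetric ones, while k = 0 is the empty sum. *)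
Definition cumsum (eps : F) (k m : nat) (B : 'M[F]_m) : algC :=
  \sum_(A : 'M[F]_m | sesq eps A && (\rank A < k)%N) chi (\tr (B^T *m A)).

Definition gsum (m : nat) (B : 'M[F]_m) : algC := \sum_(u : 'rV_m) chi (qform B u).

Definition ranksum (eps : F) (k m : nat) (B : 'M[F]_m) : algC :=
  \sum_(A : 'M[F]_m | sesq eps A && (\rank A == k)%N) chi (\tr (B^T *m A)).

Lemma cumsumS eps k m (B : 'M[F]_m) :
  cumsum eps k.+1 B = cumsum eps k B + ranksum eps k B.
Proof.
rewrite /cumsum /ranksum (bigID (fun A : 'M[F]_m => (\rank A < k)%N)) /=.
congr (_ + _); apply: eq_bigl => A; rewrite -andbA; congr andb; lia.
Qed.

Lemma cumsum0 eps m (B : 'M[F]_m) : cumsum eps 0 B = 0.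
Proof. by rewrite /cumsum big1 // => A; rewrite ltn0 andbF. Qed.

Lemma cumsum_cong eps k m (P B : 'M[F]_m) : P \in unitmx ->
  cumsum eps k (P *m B *m P^T) = cumsum eps k B.
Proof.
move=> uP; have uPt : P^T \in unitmx by rewrite unitmx_tr.
pose f (A : 'M[F]_m) := P^T *m A *m P.
pose g (A : 'M[F]_m) := invmx P^T *m A *m invmx P.
rewrite /cumsum [RHS](reindex f) /=; last first.
  exists g => A _; rewrite /f /g -!mulmxA;
  by rewrite ?(mulmxV, mulVmx, mulKmx, mulKVmx, mulmx1).
apply: eq_big => A => [|_].
  have := rank_cong A uPt; rewrite trmxK -/(f A) => ->; congr (_ && _).
  apply/idP/idP => [sA|/eqP sA]; first by have := sesq_cong P^T sA; rewrite trmxK.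
  have -> : A = g (f A).
    by rewrite /f /g -!mulmxA mulmxV // mulmx1 mulKmx.
  have := sesq_cong (invmx P^T) (introT eqP sA); rewrite /g.
  by rewrite -trmx_inv trmxK.
congr chi; rewrite /f !trmx_mul trmxK -!mulmxA mxtrace_mulC.
by rewrite !mulmxA mxtrace_mulC !mulmxA.
Qed.

Lemma gsum_cong m (P B : 'M[F]_m) : P \in unitmx ->
  gsum (P *m B *m P^T) = gsum B.
Proof.
move=> uP; rewrite /gsum [RHS](reindex_inj (can_inj (mulmxK uP))) /=.
by apply: eq_bigr => u _; rewrite /qform trmx_mul !mulmxA.
Qed.

Section Border.
Variable eps : F.
Hypothesis eps2 : eps * eps = 1.

Lemma sum_border n (f : 'M[F]_(1 + n) -> algC) :
  \sum_(C | sesq eps C) f C =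
  \sum_(A : 'M_n | sesq eps A) \sum_v \sum_(y | y == eps * y) f (border eps y v A).
Proof.
pose b (p : 'M[F]_n * ('rV[F]_n * F)) := border eps p.2.2 p.2.1 p.1.
pose c (C : 'M[F]_(1 + n)) := (drsubmx C, (ursubmx C, C 0 0)).
under [RHS]eq_bigr do rewrite pair_big /=.
rewrite pair_big /= (reindex b) /=.
  apply: eq_big => [[A [v y]]|[A [v y]] _ //].
  by rewrite /b /= sesq_border // andbC.
exists c => [[A [v y]] _|C]; rewrite /b /c /=.
  rewrite block_mxKdr block_mxKur; congr (_, (_, _)).
  exact: border00.
by rewrite inE /= => sC; rewrite -border_submx.
Qed.

Lemma row_space_form_fixed n (A : 'M[F]_n) v : sesq eps A -> (v <= A)%MS ->
  row_space_form A v == eps * row_space_form A v.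
Proof.
by move=> sA /submxP[u ->]; rewrite (row_space_formE eps2) // (qform_eps _ sA).
Qed.

(** The common form of all the recursions.  For fixed A and v the corner y is
    free when the rank stays below the bound whatever y is, is forced to be
    row_space_form A v when A has the top rank k + 1, and is impossible
    otherwise.  The three summands are the cases where v is arbitrary, where v
    must lie in the row space with y free, and where y is forced. *)
Lemma sum_border_rank k n (w : 'M[F]_n -> algC) (h : 'rV[F]_n -> algC)
    (g : F -> algC) (G := \sum_(y | y == eps * y) g y) :
  \sum_(C : 'M_(1 + n) | sesq eps C && (\rank C < k.+2)%N)
    g (C 0 0) * h (ursubmx C) * w (drsubmx C) =
  \sum_(A | sesq eps A)
    w A * ((\rank A < k)%:R * (G * \sum_v h v) +
           (\rank A == k)%:R * (G * \sum_(v | (v <= A)%MS) h v) +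
           (\rank A == k.+1)%:R *
             \sum_(v | (v <= A)%MS) h v * g (row_space_form A v)).
Proof.
rewrite big_mkcondr sum_border //; apply: eq_bigr => A sA.
have inner v : \sum_(y | y == eps * y)
    (if (\rank (border eps y v A) < k.+2)%N
     then g (border eps y v A 0 0) * h (ursubmx (border eps y v A))
            * w (drsubmx (border eps y v A)) else 0) =
  w A * (if (v <= A)%MS then
           ((\rank A < k)%:R + (\rank A == k)%:R) * (G * h v)
           + (\rank A == k.+1)%:R * (h v * g (row_space_form A v))
         else (\rank A < k)%:R * (G * h v)).
  under eq_bigr => y _.
    rewrite border00 block_mxKdr block_mxKur rank_border //.
    over.
  have all_y (b : bool) : \sum_(y | y == eps * y)
      (if b then g y * h v * w A else 0) = w A * (b%:R * (G * h v)).
    case: b; last by rewrite big1 // mul0r mulr0.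
    by rewrite -!mulr_suml mul1r mulrC.
  case: ifP => vA; last first.
    by rewrite -all_y; apply: eq_bigr => y _; rewrite addn2 !ltnS.
  (* From here on v lies in the row space: only the rank of A matters. *)
  have [rk|rk|rk] := ltngtP (\rank A) k.+1.
  - have -> : ((\rank A < k)%:R + (\rank A == k)%:R : algC) = true%:R.
      by move: rk; rewrite ltnS leq_eqVlt; case: ltngtP; rewrite ?addr0 ?add0r.
    rewrite mul0r addr0 -all_y; apply: eq_bigr => y _.
    by rewrite ifT //; case: (_ != _) => /=; lia.
  - have -> : (\rank A < k)%N = false by lia.
    have -> : (\rank A == k)%N = false by lia.
    rewrite addr0 !mul0r addr0 mulr0 big1 // => y _.
    by case: ifP => //; lia.
  - have -> : (\rank A < k)%N = false by lia.
    have -> : (\rank A == k)%N = false by lia.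
    rewrite addr0 !mul0r add0r mul1r rk.
    rewrite (bigD1 (row_space_form A v)) ?row_space_form_fixed //= eqxx addn0 ltnSn.
    rewrite big1 ?addr0 => [|y /andP[_ /negPf ->]]; last by rewrite addn1 ltnn.
    by rewrite mulrC [g _ * _]mulrC.
rewrite (eq_bigr _ (fun v _ => inner v)) -mulr_sumr; congr (w A * _).
rewrite (bigID (fun v => (v <= A)%MS)) /=.
rewrite (eq_bigr (fun v => ((\rank A < k)%:R + (\rank A == k)%:R) * (G * h v)
           + (\rank A == k.+1)%:R * (h v * g (row_space_form A v)))); last by move=> v ->.
rewrite [X in _ + X](eq_bigr (fun v => (\rank A < k)%:R * (G * h v))); last first.
  by move=> v /negPf ->.
rewrite big_split /= -!mulr_sumr [\sum_v h v](bigID (fun v => (v <= A)%MS)) /=.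
by ring.
Qed.
End Border.

(** The symmetric off-diagonal blocks are counted twice, whence the factor 2. *)
Lemma trace_border eps n y1 y2 (v1 v2 : 'rV[F]_n) (A1 A2 : 'M_n) :
  eps * eps = 1 ->
  \tr ((border eps y1 v1 A1)^T *m border eps y2 v2 A2) =
  y1 * y2 + (v2 *m (2%:R *: v1^T)) 0 0 + \tr (A1^T *m A2).
Proof.
move=> eps2; rewrite /border tr_block_mx mulmx_block mxtrace_block.
rewrite !mxtraceD [\tr (v1^T *m v2)]mxtrace_mulC.
have -> : (eps *: v1^T)^T *m (eps *: v2^T) = (v2 *m v1^T)^T.
  rewrite [(eps *: _)^T]linearZ /= trmxK -scalemxAl -scalemxAr scalerA eps2.
  by rewrite scale1r trmx_mul trmxK.
rewrite mxtrace_tr !trace_mx11 tr_scalar_mx -scalar_mxM -scalemxAr.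
by rewrite ![(_ *: _ : 'M_1) 0 0]mxE [_%:M 0 0]mxE mulr1n; ring.
Qed.

Lemma sum_chi_row_space p n (A : 'M[F]_(p, n)) (c : 'cV_n) :
  \sum_(v : 'rV_n | (v <= A)%MS) chi ((v *m c) 0 0) = (A *m c == 0)%:R * q ^+ \rank A.
Proof.
have := sum_row_space A (fun v => chi ((v *m c) 0 0)).
under eq_bigr do rewrite -mulmxA.
rewrite sum_chi_dot.
have -> : q ^+ p = q ^+ (p - \rank A) * q ^+ \rank A.
  by rewrite -exprD subnK ?rank_leq_row.
move=> E; apply: (mulfI (expf_neq0 (p - \rank A) (q_neq0 F))).
by rewrite -E mulrCA.
Qed.

(** The number of possible diagonal entries of a matrix with A^T = eps A, through
    which the symmetric and the skew-symmetric recursions come to differ. *)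
Definition num_diag (eps : F) : algC := #|[pred y : F | y == eps * y]|%:R.

Lemma num_diag_symm : num_diag 1 = q.
Proof. by congr _%:R; apply: eq_card => y; rewrite !inE mul1r eqxx. Qed.

Lemma num_diag_skew : num_diag (-1) = 1.
Proof.
rewrite /num_diag -[RHS]/(1%N%:R) -(card1 (0 : F)); congr _%:R.
apply: eq_card => y; rewrite !inE.
by rewrite mulN1r -addr_eq0 -mulr2n -mulr_natr mulf_eq0 (negPf two_neq0) orbF.
Qed.

Lemma trace_border0 eps n y1 y2 (v2 : 'rV[F]_n) (A1 A2 : 'M_n) :
  eps * eps = 1 ->
  \tr ((border eps y1 0 A1)^T *m border eps y2 v2 A2) = y1 * y2 + \tr (A1^T *m A2).
Proof. by move=> e2; rewrite trace_border // trmx0 scaler0 mulmx0 mxE addr0. Qed.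

Lemma trace_hplus eps n y (v : 'rV[F]_(1 + n)) (A : 'M_n) (C : 'M_(1 + n)) :
  eps * eps = 1 ->
  \tr ((hplus eps A)^T *m border eps y v C) =
  (v *m col_mx 1%:M 0) 0 0 + \tr ((border eps 0 0 A)^T *m C).
Proof.
move=> e2; rewrite trace_border // mul0r add0r; congr ((_ *m _) 0 0 + _).
rewrite tr_row_mx trmx0 scale_col_mx scaler0 tr_scalar_mx scale_scalar_mx.
by rewrite divff.
Qed.

Lemma cumsumE eps k m (B : 'M[F]_m) : cumsum eps k B =
  \sum_(A : 'M[F]_m | sesq eps A) (\rank A < k)%:R * chi (\tr (B^T *m A)).
Proof.
by rewrite /cumsum big_mkcondr; apply: eq_bigr => A _; case: ifP; rewrite ?mul1r ?mul0r.
Qed.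

Lemma ranksumE eps k m (B : 'M[F]_m) : ranksum eps k B =
  \sum_(A : 'M[F]_m | sesq eps A) (\rank A == k)%:R * chi (\tr (B^T *m A)).
Proof.
by rewrite /ranksum big_mkcondr; apply: eq_bigr => A _; case: ifP; rewrite ?mul1r ?mul0r.
Qed.

Lemma border_col0 eps n y (v : 'rV[F]_n) A : eps * eps = 1 ->
  (border eps y v A *m col_mx 1%:M 0 == 0) = (y == 0) && (v == 0).
Proof.
move=> e2; rewrite /border mul_block_col !mulmx0 !addr0 !mulmx1.
apply/eqP/andP => [|[/eqP-> /eqP->]]; last first.
  by rewrite raddf0 trmx0 scaler0 col_mx0.
rewrite -[0]col_mx0 => /eq_col_mx[/matrixP/(_ 0 0)].
rewrite !mxE mulr1n => -> /(congr1 (fun x => (eps *: x)^T)).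
by rewrite scalerA e2 scale1r trmxK scaler0 trmx0 => ->; rewrite !eqxx.
Qed.

(** Peel off the two basis vectors of the plane in turn.  At the first step the
    argument pairs the border z with its first coordinate only, so the sum over
    all z vanishes, and the sum over the z in the row space of C vanishes unless
    the first column of C is zero.  At the second step this forces the border of C
    to be zero, which leaves the matrices of rank k and k + 1 of the original
    size. *)
Lemma cumsum_hplus eps k n (B : 'M[F]_n) : eps * eps = 1 -> sesq eps B ->
  cumsum eps k.+2 (hplus eps B) =
  num_diag eps * q ^+ k * ranksum eps k B + q ^+ k.+1 * ranksum eps k.+1 B.
Proof.
move=> e2 sB; pose c : 'cV[F]_(1 + n) := col_mx 1%:M 0.
pose h (z : 'rV_(1 + n)) := chi ((z *m c) 0 0).
pose w (C : 'M_(1 + n)) := chi (\tr ((border eps 0 0 B)^T *m C)).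
have c0 : (c == 0) = false.
  apply/negbTE/eqP => /matrixP/(_ (lshift n 0) 0).
  by rewrite col_mxEu !mxE => /eqP; rewrite oner_eq0.
rewrite /cumsum (eq_bigr (fun C : 'M_(1 + (1 + n)) =>
   1 * h (ursubmx C) * w (drsubmx C))); last first.
  move=> C /andP[sC _]; rewrite {1}(border_submx e2 sC) trace_hplus //.
  by rewrite chiD mul1r.
rewrite (sum_border_rank e2 k w h (fun _ => 1)).
have -> : \sum_(v : 'rV[F]_(1 + n)) h v = 0.
  by rewrite sum_chi_dot c0 mul0r.
have -> : \sum_(y | y == eps * y) 1 = num_diag eps by rewrite sumr_const.
under eq_bigr => A sA.
  under [X in _ + _ * X]eq_bigr do rewrite mulr1.
  rewrite [\sum_(v | (v <= A)%MS) h v]sum_chi_row_space.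
  over.
(* Only the zero border survives in the second step. *)
rewrite sum_border // !ranksumE !mulr_sumr -big_split /=; apply: eq_bigr => A sA.
rewrite (bigD1 0) //= (bigD1 0) /=; last by rewrite mulr0.
rewrite big1 ?addr0 => [|y /andP[_ y0]]; last first.
  by rewrite border_col0 // (negPf y0) /= mul0r !mulr0 !addr0 mulr0.
rewrite big1 ?addr0 => [|v v0]; last first.
  apply: big1 => y _; rewrite border_col0 // (negPf v0) andbF /= mul0r.
  by rewrite !mulr0 !addr0 mulr0.
rewrite border_col0 // !eqxx mul1r !mulr0 add0r /w trace_border0 // mul0r add0r.
rewrite border0_rank // eqxx add0n.
have [->|] := eqVneq (\rank A) k; first by rewrite (ltn_eqF (ltnSn k)) /=; ring.
have [->|] := eqVneq (\rank A) k.+1; first by move=> _ /=; ring.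
by move=> _ _ /=; ring.
Qed.

(** At argument 0 this is the recursion in n for the number of matrices of
    bounded rank. *)
Lemma cumsum_zero eps k n : eps * eps = 1 ->
  cumsum eps k.+2 (0 : 'M[F]_(1 + n)) =
  num_diag eps * q ^+ n * cumsum eps k (0 : 'M_n)
  + num_diag eps * q ^+ k * ranksum eps k (0 : 'M_n)
  + q ^+ k.+1 * ranksum eps k.+1 (0 : 'M_n).
Proof.
move=> e2; have t0 m (A : 'M[F]_m) : chi (\tr (0^T *m A)) = 1.
  by rewrite trmx0 mul0mx mxtrace0.
have row_card (A : 'M[F]_n) : \sum_(v : 'rV[F]_n | (v <= A)%MS) 1 = q ^+ \rank A :> algC.
  have := sum_chi_row_space A 0; rewrite mulmx0 eqxx mul1r => <-.
  by apply: eq_bigr => v _; rewrite mulmx0 mxE chi0.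
rewrite /cumsum (eq_bigr (fun C : 'M_(1 + n) =>
   1 * (fun _ => 1) (ursubmx C) * (fun _ => 1) (drsubmx C))); last first.
  by move=> C _; rewrite t0 !mulr1.
rewrite (sum_border_rank e2 k (fun _ => 1) (fun _ => 1) (fun _ => 1)).
have -> : \sum_(y | y == eps * y) 1 = num_diag eps by rewrite sumr_const.
rewrite -/(cumsum eps k (0 : 'M_n)) cumsumE !ranksumE !mulr_sumr -!big_split /=.
apply: eq_bigr => A sA; rewrite t0.
under [X in _ + _ * X]eq_bigr do rewrite mulr1.
rewrite row_card sumr_const card_mx mul1n.
rewrite -[num_diag eps * 1 *+ _]mulr_natr natrX mulr1.
have [->|] := eqVneq (\rank A) k; first by rewrite (ltn_eqF (ltnSn k)) /=; ring.
have [->|] := eqVneq (\rank A) k.+1; first by move=> _ /=; ring.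
by move=> _ _ /=; ring.
Qed.

(** Peeling off a diagonal entry b: the free corner kills every A except those
    of top rank k + 1, for which the corner forced by v contributes a Gauss sum
    over the row space.  The power of q converts the latter into a sum over all
    rows. *)
Lemma cumsum_diag k n b (B : 'M[F]_n) : b != 0 ->
  cumsum 1 k.+2 (border 1 b 0 B) * q ^+ (n - k.+1) =
  \sum_(A : 'M[F]_n | sesq 1 A && (\rank A == k.+1))
     chi (\tr (B^T *m A)) * gsum (b *: A).
Proof.
move=> b0.
rewrite /cumsum (eq_bigr (fun C : 'M_(1 + n) =>
   chi (b * C 0 0) * (fun _ => 1) (ursubmx C) *
   (fun A => chi (\tr (B^T *m A))) (drsubmx C))); last first.
  move=> C /andP[sC _]; rewrite {1}(border_submx one2 sC) trace_border0 //.
  by rewrite chiD mulr1.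
rewrite (sum_border_rank one2 k (fun A => chi (\tr (B^T *m A))) (fun _ => 1)
          (fun y => chi (b * y))).
have -> : \sum_(y | y == 1 * y) chi (b * y) = 0.
  rewrite -[RHS](sum_chi_scale b0); apply: eq_bigl => y.
  by rewrite mul1r eqxx.
rewrite mulr_suml big_mkcondr; apply: eq_bigr => A sA.
rewrite !mul0r !mulr0 !add0r; case: eqP => [rA|_]; last by rewrite mul0r mulr0 mul0r.
rewrite mul1r -mulrA; congr (_ * _); rewrite mulrC -rA.
under eq_bigr do rewrite mul1r.
rewrite -(sum_row_space A (fun v => chi (b * row_space_form A v))).
apply: eq_bigr => u _; rewrite (row_space_formE one2 _ sA); congr chi.
by rewrite /qform -scalemxAr -scalemxAl [RHS]mxE.
Qed.

(** * Quadratic Gauss sums *)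

Definition is_square (F : finFieldType) (c : F) := [exists x : F, x ^+ 2 == c].

(** The quadratic character on nonzero elements. *)
Definition qchar (F : finFieldType) (c : F) : algC := if is_square c then 1 else -1.

(** The squares and their multiples by a nonsquare cover every element twice.
    An element y has at most two preimages in all, since for y nonzero x^2 = y and
    c x'^2 = y would make c a square; both sides have total 2q over all y, so the
    bound is attained everywhere. *)
Lemma card_sqrt_twist (c : F) : ~~ is_square c -> forall y : F,
  (#|[pred x : F | (x ^+ 2 == y)%R]| + #|[pred x : F | (c * x ^+ 2 == y)%R]| = 2)%N.
Proof.
move=> cN; have c0 : c != 0.
  by apply: contraNneq cN => ->; apply/existsP; exists 0; rewrite expr0n.
apply: sum_eq_bounded => [y|].
  have E : #|[pred x : F | c * x ^+ 2 == y]| = #|[pred x : F | x ^+ 2 == c^-1 * y]|.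
    by apply: eq_card => x; rewrite !inE -(inj_eq (mulfI (invr_neq0 c0))) mulKf.
  have [->|y0] := eqVneq y 0.
    rewrite (eq_card (B := pred1 0)) ?card1 => [|x]; last by rewrite !inE expf_eq0.
    rewrite (eq_card (B := pred1 0)) ?card1 // => x.
    by rewrite !inE mulf_eq0 (negPf c0) expf_eq0.
  have [[s /eqP ys]|no] := altP (@existsP _ (fun x : F => x ^+ 2 == y)).
    rewrite [X in (_ + X)%N]eq_card0 ?addn0 ?card_sqrt // => x; rewrite !inE.
    apply: contraNF cN => /eqP cx; apply/existsP; exists (s / x).
    have x0 : x != 0.
      by apply: contraNneq y0 => x0; rewrite -cx x0 expr0n mulr0.
    by rewrite expr_div_n ys -cx mulfK // expf_neq0.
  rewrite eq_card0 ?add0n ?E ?card_sqrt // => x; rewrite !inE.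
  by apply: contraNF no => xy; apply/existsP; exists x.
have part (f : F -> F) : (\sum_y #|[pred x : F | f x == y]| = #|F|)%N.
  rewrite -[RHS]sum1_card [RHS](partition_big f xpredT) //=.
  by apply: eq_bigr => y _; rewrite -sum1_card.
by rewrite big_split /= !part sum_nat_const addnn -muln2.
Qed.

Definition gauss (b : F) : algC := \sum_x chi (b * x ^+ 2).

(** For a nonsquare c the sums for b and b c add up to twice the full character
    sum, which is zero. *)
Lemma gauss_scale b c : b != 0 -> c != 0 -> gauss (b * c) = qchar c * gauss b.
Proof.
move=> b0 c0; rewrite /qchar; case: ifPn => [/existsP[s /eqP sE]|cN].
  have s0 : s != 0 by apply: contraNneq c0 => s0; rewrite -sE s0 expr0n.
  rewrite mul1r /gauss [RHS](reindex_inj (mulfI s0)) /=.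
  by apply: eq_bigr => x _; rewrite exprMn sE !mulrA.
rewrite mulN1r; apply/eqP; rewrite -addr_eq0; apply/eqP.
have part (f : F -> F) : \sum_x chi (b * f x) =
    \sum_y #|[pred x : F | f x == y]|%:R * chi (b * y).
  rewrite (partition_big f xpredT) //=; apply: eq_bigr => y _.
  rewrite (eq_bigr (fun _ => chi (b * y))) => [|x /eqP-> //].
  by rewrite sumr_const mulr_natl.
rewrite /gauss (part (fun x => x ^+ 2)).
under eq_bigr do rewrite -mulrA.
rewrite (part (fun x => c * x ^+ 2)) -big_split /=.
under eq_bigr => y _.
  rewrite -mulrDl -natrD addnC card_sqrt_twist //.
  over.
by rewrite -mulr_sumr sum_chi_scale // mulr0.
Qed.

Lemma sum_rV_split a b (f : 'rV[F]_(a + b) -> algC) :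
  \sum_u f u = \sum_x \sum_y f (row_mx x y).
Proof.
rewrite pair_big /= (reindex (fun p : 'rV_a * 'rV[F]_b => row_mx p.1 p.2)) //=.
exists (fun u => (lsubmx u, rsubmx u)) => [[x y] _|u _] /=; last by rewrite hsubmxK.
by rewrite row_mxKl row_mxKr.
Qed.

Lemma sum_rV1 n (f : 'rV[F]_(1 + n) -> algC) :
  \sum_u f u = \sum_x \sum_v f (row_mx x%:M v).
Proof.
rewrite sum_rV_split (reindex (fun x : F => x%:M : 'rV_1)) //=.
exists (fun u : 'rV_1 => u 0 0) => u _; last by rewrite -mx11_scalar.
by rewrite mxE eqxx mulr1n.
Qed.

Lemma gsum_border0 n b (A : 'M[F]_n) :
  gsum (border 1 b 0 A) = gauss b * gsum A.
Proof.
rewrite /gsum sum_rV1 /gauss mulr_suml; apply: eq_bigr => x _.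
by rewrite mulr_sumr; apply: eq_bigr => v _; rewrite qform_row1 chiD.
Qed.

Lemma gsum0 m : gsum (0 : 'M[F]_m) = q ^+ m.
Proof.
rewrite /gsum (eq_bigr (fun _ => 1)) => [|u _].
  by rewrite sumr_const card_mx mul1n natrX.
by rewrite /qform mulmx0 mul0mx mxE.
Qed.

Lemma qform_hplus n x y (z : 'rV[F]_n) (A : 'M[F]_n) :
  qform (hplus 1 A) (row_mx x%:M (row_mx y%:M z)) = x * y + qform A z.
Proof.
rewrite /qform hplus_mul !tr_row_mx !mul_row_col !tr_scalar_mx -!scalar_mxM mul1r.
rewrite ![(_ + _ : 'M_1) 0 0]mxE ![_%:M 0 0]mxE /=.
by rewrite addrA; congr (_ + _); field.
Qed.

Lemma gsum_hplus n (A : 'M[F]_n) : gsum (hplus 1 A) = q * gsum A.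
Proof.
rewrite /gsum sum_rV1.
under eq_bigr do rewrite sum_rV1.
under eq_bigr do under eq_bigr do under eq_bigr do rewrite qform_hplus chiD.
under eq_bigr do under eq_bigr do rewrite -mulr_sumr.
under eq_bigr do rewrite -mulr_suml.
rewrite -mulr_suml; congr (_ * _); rewrite (bigD1 0) //=.
rewrite [X in _ + X]big1 => [|x x0]; last exact: (sum_chi_scale x0).
rewrite addr0 (eq_bigr (fun _ => 1)) ?sumr_const // => y _.
by rewrite mul0r.
Qed.

Lemma qchar_sqr (c : F) : qchar c * qchar c = 1 :> algC.
Proof. by rewrite /qchar; case: ifP; rewrite ?mulr1 ?mulrNN ?mulr1. Qed.

(** Diagonalize and scale each diagonal entry. *)
Lemma gsum_scale m c (B : 'M[F]_m) : sesq 1 B -> c != 0 ->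
  gsum (c *: B) = qchar c ^+ \rank B * gsum B.
Proof.
move=> sB c0; elim: m B sB => [|n IH] B sB.
  by rewrite (flatmx0 B) scaler0 mxrank0 mul1r.
have [->|B0] := eqVneq B 0; first by rewrite scaler0 mxrank0 mul1r.
have [P [b [B' [uP b0 sB' PE]]]] := @diagonal_split n B sB B0.
have rB : \rank B = (\rank B').+1.
  by rewrite -(rank_cong B uP) PE border0_rank // b0.
rewrite -(gsum_cong B uP) -(gsum_cong (c *: B) uP) -scalemxAr -scalemxAl PE.
have -> : c *: border 1 b 0 B' = border 1 (b * c) 0 (c *: B').
  by rewrite /border scale_block_mx !trmx0 !scaler0 scale_scalar_mx mulrC.
by rewrite !gsum_border0 gauss_scale // IH // rB exprS; ring.
Qed.

(** * The symmetric sums in terms of the skew-symmetric ones *)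

Lemma ranksum_skew_odd k m (B : 'M[F]_m) : odd k -> ranksum (-1) k B = 0.
Proof.
move=> ok; rewrite /ranksum big1 // => A /andP[sA /eqP rA].
by have := skew_rank_even sA; rewrite rA ok.
Qed.

Lemma cumsum_hplus_symm k n (B : 'M[F]_n) : sesq 1 B ->
  cumsum 1 k.+2 (hplus 1 B) = q ^+ k.+1 * (cumsum 1 k.+2 B - cumsum 1 k B).
Proof.
move=> sB; rewrite (cumsum_hplus k one2 sB).
by rewrite num_diag_symm !cumsumS exprS; ring.
Qed.

Lemma cumsum_hplus_skew k n (B : 'M[F]_n) : ~~ odd k -> sesq (-1) B ->
  cumsum (-1) k.+2 (hplus (-1) B) = q ^+ k * ranksum (-1) k B.
Proof.
move=> ek sB; rewrite (cumsum_hplus k mone2 sB).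
by rewrite num_diag_skew (ranksum_skew_odd (k := k.+1)) //=; ring.
Qed.

(** There are q^m times as many symmetric matrices of rank below k as
    skew-symmetric ones: both counts satisfy the recursion cumsum_zero, and for
    even k the q corner entries available in the symmetric case supply the
    additional factor q. *)
Lemma cumsum_zero_ratio k m : ~~ odd k ->
  cumsum 1 k (0 : 'M[F]_m) = q ^+ m * cumsum (-1) k (0 : 'M_m).
Proof.
elim: m k => [|n IH] k ek.
  rewrite mul1r /cumsum; apply: eq_bigl => A.
  by rewrite /sesq [A]flatmx0 !trmx0 !scaler0.
case: k ek => [|[|k]] //; first by rewrite !cumsum0 mulr0.
rewrite /= negbK => ek.
rewrite (cumsum_zero k n one2) (cumsum_zero k n mone2).
rewrite num_diag_symm num_diag_skew (ranksum_skew_odd (k := k.+1)) //=.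
have := IH k.+2; rewrite /= negbK => /(_ ek).
rewrite !cumsumS IH // (ranksum_skew_odd (k := k.+1)) //= addr0 mulrDr -addrA.
move=> /addrI E; have {E}-> : ranksum 1 k.+1 (0 : 'M_n) =
  q ^+ n * ranksum (-1) k (0 : 'M_n) - ranksum 1 k (0 : 'M_n).
  by rewrite -E; ring.
by rewrite !exprS; ring.
Qed.

(** By cumsum_diag only the Gauss sums of b A with A of odd rank k - 1 occur, so
    a factor qchar c survives. *)
Lemma cumsum_border0_twist k n b c (B : 'M[F]_n) : ~~ odd k -> b != 0 -> c != 0 ->
  cumsum 1 k (border 1 (b * c) 0 B) = qchar c * cumsum 1 k (border 1 b 0 B).
Proof.
case: k => [|[|k]] //; first by rewrite !cumsum0 mulr0.
rewrite /= negbK => ek b0 c0.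
apply: (mulIf (expf_neq0 (n - k.+1) (q_neq0 F))).
rewrite -mulrA !(cumsum_diag) // ?mulf_neq0 //.
rewrite mulr_sumr; apply: eq_bigr => A /andP[sA /eqP rA].
rewrite mulrCA; congr (_ * _).
have -> : (b * c) *: A = c *: (b *: A) by rewrite scalerA mulrC.
have sbA : sesq 1 (b *: A) by rewrite /sesq linearZ /= (eqP sA) !scale1r.
rewrite (gsum_scale sbA c0) mxrank_scale_nz // rA.
congr (_ * _); rewrite exprS; have -> : qchar c ^+ k = 1; last by rewrite mulr1.
rewrite -[k]odd_double_half (negPf ek) add0n -mul2n exprM.
by rewrite expr2 qchar_sqr expr1n.
Qed.

(** Up to the common sign qchar c, both sums see B as a hyperbolic plane added to
    a matrix B' of rank two less.  The matrix B' itself need not be an orthogonal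
    summand of B, because the plane of B may be anisotropic. *)
Lemma plane_reduction m (B : 'M[F]_m) : sesq 1 B -> (1 < \rank B)%N ->
  exists n (B' : 'M[F]_n) (c : F), [/\ m = n.+2 /\ c != 0, sesq 1 B',
    \rank B = (\rank B').+2, gsum B = qchar c * (q * gsum B') &
    forall k, ~~ odd k ->
      cumsum 1 k B = qchar c * cumsum 1 k (hplus 1 B')].
Proof.
move=> sB rB; have m2 : (1 < m)%N := leq_trans rB (rank_leq_col B).
case: m B sB rB m2 => [|[|n]] // B sB rB _; exists n.
have B0 : B != 0 by apply: contraTneq rB => ->; rewrite mxrank0.
have [P [b [B1 [uP b0 sB1 PE]]]] := @diagonal_split n.+1 B sB B0.
have rB1 : \rank B = (\rank B1).+1.
  by rewrite -(rank_cong B uP) PE border0_rank // b0.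
have B10 : B1 != 0 by apply: contraTneq rB => B10; rewrite rB1 B10 mxrank0.
have [P1 [b1 [B2 [uP1 b10 sB2 PE1]]]] := @diagonal_split n B1 sB1 B10.
pose P2 : 'M[F]_(1 + n.+1) := block_mx 1%:M 0 0 P1 *m P.
have uP2 : P2 \in unitmx by rewrite unitmx_mul unit_diag1.
have PE2 : P2 *m B *m P2^T = border 1 b 0 (border 1 b1 0 B2).
  rewrite /P2 trmx_mul -!mulmxA [P *m _]mulmxA [_ *m (P^T *m _)]mulmxA PE.
  by rewrite mulmxA border0_cong PE1.
(* This choice turns diag(b, b1) into diag(- b1, b1), where (1, 1) is isotropic. *)
pose c := - b1 / b; have c0 : c != 0 by rewrite mulf_neq0 ?oppr_eq0 ?invr_eq0.
have bc : b * c = - b1 by rewrite mulrC divfK.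
pose B3 := border 1 (- b1) 0 (border 1 b1 0 B2).
have sB1' : sesq 1 (border 1 b1 0 B2) by rewrite sesq_border // mul1r eqxx.
have sB3 : sesq 1 B3 by rewrite sesq_border // mul1r eqxx.
pose x : 'rV[F]_(1 + (1 + n)) := row_mx 1%:M (row_mx 1%:M 0).
have qx : qform B3 x = 0.
  by rewrite !qform_row1 /qform !mul0mx mxE expr1n; ring.
have xB3 : x *m B3 != 0.
  rewrite /x /B3 {1}/border mul_row_block trmx0 scaler0 mulmx0 addr0 mul1mx.
  apply: contraNneq b10 => /(congr1 lsubmx); rewrite row_mxKl.
  by move/matrixP/(_ 0 0)/eqP; rewrite !mxE eqxx mulr1n oppr_eq0.
have [P3 [B' [uP3 sB' PE3]]] := isotropic_split one2 sB3 qx xB3.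
exists B', c; split=> //.
- rewrite -(rank_cong B uP2) PE2 -(rank_hplus one2 sB') -PE3 rank_cong //.
  by rewrite !border0_rank // oppr_eq0 b0 b10.
- rewrite -gsum_hplus -PE3 gsum_cong // -(gsum_cong B uP2) PE2.
  rewrite gsum_border0 // /B3 gsum_border0 // -bc gauss_scale // !mulrA qchar_sqr mul1r //.
- move=> k ek; rewrite -PE3 cumsum_cong // -(cumsum_cong _ k B uP2) PE2.
  by rewrite /B3 -bc cumsum_border0_twist // mulrA qchar_sqr mul1r.
Qed.

Lemma skew_split n (C : 'M[F]_(n.+2)) : sesq (-1) C -> C != 0 ->
  exists2 C' : 'M[F]_n, sesq (-1) C' & \rank C = (\rank C').+2 /\
    forall k, cumsum (-1) k C = cumsum (-1) k (hplus (-1) C').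
Proof.
move=> sC C0; have [x xC] := neq0_row C0.
have [P [C' [uP sC' PE]]] :=
  @isotropic_split (-1) mone2 n C x sC (skew_qform x sC) xC.
exists C' => //; split=> [|k]; last by rewrite -PE cumsum_cong.
by rewrite -(rank_cong C uP) PE rank_hplus.
Qed.

(** The factorization S = G R.  The hypotheses determine C only up to congruence,
    which is harmless since R is invariant under it. *)
Lemma cumsum_symm_skew l m k (B C : 'M[F]_m) : ~~ odd k ->
  sesq 1 B -> sesq (-1) C -> \rank B = l.*2 -> \rank C = l.*2 ->
  cumsum 1 k B = gsum B * cumsum (-1) k C.
Proof.
elim: l m k B C => [|l IH] m k B C ek sB sC rB rC.
  have /eqP := rB; rewrite mxrank_eq0 => /eqP ->.
  have /eqP := rC; rewrite mxrank_eq0 => /eqP ->.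
  by rewrite gsum0 cumsum_zero_ratio.
have [|n [B' [c [[mn c0] sB' rB' gB SB]]]] := plane_reduction sB; first by rewrite rB.
subst m; have C0 : C != 0 by rewrite -mxrank_eq0 rC.
have [C' sC' [rC' SC]] := skew_split sC C0.
case: k ek => [|[|k]] //; first by rewrite !cumsum0 mulr0.
move=> ek; have ek' : ~~ odd k by move: ek; rewrite /= negbK.
move: rB' rC'; rewrite rB rC doubleS => -[rB'] [rC'].
rewrite SB // gB SC cumsum_hplus_symm // cumsum_hplus_skew //.
rewrite !(IH n _ B' C') // !cumsumS (ranksum_skew_odd (k := k.+1)) //= exprS.
by ring.
Qed.

Lemma nonsquare : exists2 c : F, c != 0 & ~~ is_square c.
Proof.
have : ~~ injectiveb (fun x : F => x ^+ 2).
  apply/injectiveP => /(_ 1 (-1)); rewrite sqrrN => /(_ erefl)/eqP.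
  by rewrite -addr_eq0 -mulr2n (negPf two_neq0).
move=> ninj; have : [exists c : F, ~~ is_square c].
  apply: contraR ninj; rewrite negb_exists => /forallP sq.
  have bij : codom (fun x : F => x ^+ 2) =i F.
    move=> y; apply/codomP; have := sq y; rewrite negbK => /existsP[x /eqP <-].
    by exists x.
  by rewrite /injectiveb /dinjectiveb; apply/card_uniqP;
  rewrite (eq_card bij) size_map -cardE.
case/existsP=> c cN; exists c => //; apply: contraNneq cN => ->.
by apply/existsP; exists 0; rewrite expr0n.
Qed.

Lemma qchar_nonsquare : exists2 c : F, c != 0 & qchar c = -1.
Proof. by have [c c0 /negPf cN] := nonsquare; exists c; rewrite // /qchar cN. Qed.

Lemma sesq1_scale m c (A : 'M[F]_m) : sesq 1 A -> sesq 1 (c *: A).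
Proof. by move=> /eqP sA; rewrite /sesq linearZ /= sA !scale1r. Qed.

(** Here B is congruent to diag(b, 0), so the sum is over Gauss sums of b A with
    A of odd rank; substituting c A for A with c a nonsquare changes the sign. *)
Lemma cumsum_rank1 k m (B : 'M[F]_m) : ~~ odd k -> sesq 1 B -> \rank B = 1 ->
  cumsum 1 k B = 0.
Proof.
move=> ek sB rB; case: k ek => [|[|k]] //; first by rewrite !cumsum0.
rewrite /= negbK => ek; have [c c0 cE] := qchar_nonsquare.
case: m B sB rB => [|n] B sB rB; first by rewrite [B]flatmx0 mxrank0 in rB.
have B0 : B != 0 by rewrite -mxrank_eq0 rB.
have [P [b [B' [uP b0 sB' PE]]]] := @diagonal_split n B sB B0.
have B'0 : B' = 0.
  apply/eqP; rewrite -mxrank_eq0; have := rank_cong B uP.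
  by rewrite PE border0_rank // b0 rB add1n => -[->].
rewrite -(cumsum_cong _ k.+2 B uP) PE B'0.
apply: (mulIf (expf_neq0 (n - k.+1) (q_neq0 F))); rewrite mul0r cumsum_diag //.
set T := \sum_(_ | _) _; suff TN : T = - T.
  by apply/eqP; have /eqP := TN; rewrite -addr_eq0 -mulr2n mulrn_eq0.
rewrite {1}/T (reindex_inj (can_inj (scalerK c0))) /= -sumrN; apply: eq_big => A.
  rewrite mxrank_scale_nz //; congr (_ && _); apply/idP/idP; last exact: sesq1_scale.
  by move/(sesq1_scale c^-1); rewrite scalerK.
move=> /andP[]; rewrite mxrank_scale_nz // => scA /eqP rA.
have sA : sesq 1 A by have := sesq1_scale c^-1 scA; rewrite scalerK.
rewrite !trmx0 !mul0mx mxtrace0 chi0 !mul1r scalerA mulrC -scalerA.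
rewrite gsum_scale ?sesq1_scale // mxrank_scale_nz // rA cE exprS.
by rewrite -signr_odd (negPf ek) mulr1 mulN1r.
Qed.

Lemma cumsum_odd_rank l m k (B : 'M[F]_m) : ~~ odd k ->
  sesq 1 B -> \rank B = l.*2.+1 -> cumsum 1 k B = 0.
Proof.
elim: l m k B => [|l IH] m k B ek sB rB; first exact: cumsum_rank1.
have [|n [B' [c [[mn c0] sB' rB' gB SB]]]] := plane_reduction sB; first by rewrite rB.
case: k ek => [|[|k]] //; first by rewrite !cumsum0.
move=> ek; have ek' : ~~ odd k by move: ek; rewrite /= negbK.
move: rB'; rewrite rB doubleS => -[rB'].
by rewrite SB // cumsum_hplus_symm // !(IH n _ B') // subr0 !mulr0.
Qed.

Lemma qchar_pm (c : F) : qchar c = 1 \/ qchar c = -1.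
Proof. by rewrite /qchar; case: ifP; [left|right]. Qed.

(** Each reduction by a plane contributes a factor q up to sign. *)
Lemma gsum_even_rank l m (B : 'M[F]_m) : sesq 1 B -> \rank B = l.*2 ->
  gsum B = q ^+ (m - l) \/ gsum B = - q ^+ (m - l).
Proof.
elim: l m B => [|l IH] m B sB rB.
  have /eqP := rB; rewrite mxrank_eq0 => /eqP ->; left.
  by rewrite gsum0 subn0.
have [|n [B' [c [[mn c0] sB' rB' gB _]]]] := plane_reduction sB; first by rewrite rB.
subst m; move: rB'; rewrite rB doubleS => -[rB'].
have ln : (l <= n)%N by have := rank_leq_row B'; lia.
have -> : (n.+2 - l.+1 = (n - l).+1)%N by lia.
rewrite gB exprS; case: (IH n B' sB') => // ->; case: (qchar_pm c) => ->.
- by left; rewrite mul1r.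
- by right; rewrite mulN1r.
- by right; rewrite mul1r mulrN.
- by left; rewrite mulN1r mulrN opprK.
Qed.

(** * Type of a matrix of even rank *)

(** The frames that witness hyperbolicity, with the number l of planes as a free
    parameter so that planes can be added one at a time, and with the spanning
    condition stated on vectors. *)
Definition hyperbolic_frame (m l : nat) (B : 'M[F]_m) :=
  exists U V : 'M[F]_(l, m),
    (forall z : 'rV_m, exists x y w, z = x *m U + y *m V + w /\ w *m B = 0) /\
    forall x y, qform B (x *m U + y *m V) = \sum_i x 0 i * y 0 i.

Lemma hyperbolicE m l (B : 'M[F]_m) :
  \rank B = l.*2 -> hyperbolic_frame l B <-> hyperbolic B.
Proof.
move=> rB; rewrite /hyperbolic rB doubleK; split.
  move=> [U [V [span UV]]]; apply/existsP; exists U; apply/existsP; exists V.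
  apply/andP; split; last first.
    by apply/forallP=> x; apply/forallP=> y; apply/eqP; apply: UV.
  rewrite -sub1mx; apply/row_subP=> i; have [x [y [w [-> wB]]]] := span (row i 1%:M).
  rewrite addmx_sub_adds ?addmx_sub_adds ?submxMl //.
  exact/sub_kermxP.
move=> /existsP[U /existsP[V /andP[full /forallP UV]]]; exists U, V; split; last first.
  by move=> x y; apply/eqP; have /forallP := UV x; apply.
move=> z; have /sub_addsmxP[[u w] zE] := submx_full z full.
have /sub_addsmxP[[x y] /= uE] : (u *m (U + V)%MS <= U + V)%MS by exact: submxMl.
exists x, y, (w *m kermx B); rewrite -uE; split=> //.
by rewrite -mulmxA mulmx_ker mulmx0.
Qed.

Lemma qform_radical m (B : 'M[F]_m) u w : sesq 1 B -> w *m B = 0 ->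
  qform B (u + w) = qform B u.
Proof.
move=> sB wB; rewrite /qform raddfD /= mulmxDr !mulmxDl wB !mul0mx !addr0.
by rewrite [u *m B *m w^T](sesq_swap one2 _ _ sB) wB mul0mx trmx0 scaler0 addr0.
Qed.

(** In a hyperbolic frame the Gauss sum is the sum of chi (x . y) over the
    coordinates, and summing over y leaves only x = 0. *)
Lemma gsum_hyperbolic_frame m l (B : 'M[F]_m) : sesq 1 B -> \rank B = l.*2 ->
  hyperbolic_frame l B -> gsum B = q ^+ (m - l).
Proof.
move=> sB rB [U [V [span UV]]]; pose M := col_mx (col_mx U V) (kermx B).
have le_lm : (l.*2 <= m)%N by rewrite -rB rank_leq_row.
have full (v : 'rV_m) : (v <= M)%MS.
  have [x [y [w [-> /sub_kermxP/submxP[w' ->]]]]] := span v.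
  by apply/submxP; exists (row_mx (row_mx x y) w'); rewrite !mul_row_col.
have rM : \rank M = m.
  by apply/eqP; rewrite -[_ == _]/(row_full M) -sub1mx; apply/row_subP.
have := sum_row_space M (fun v => chi (qform B v)).
have -> : \sum_(v | (v <= M)%MS) chi (qform B v) = gsum B.
  by apply: eq_bigl => v; rewrite full.
rewrite rM addnK sum_rV_split.
under eq_bigr => xy _.
  under eq_bigr => w _.
    rewrite mul_row_col qform_radical //; last by rewrite -mulmxA mulmx_ker mulmx0.
    over.
  rewrite sumr_const card_mx mul1n -mulr_natr natrX.
  over.
rewrite -mulr_suml sum_rV_split.
have E (x y : 'rV[F]_l) : qform B (row_mx x y *m col_mx U V) = (y *m x^T) 0 0.
  rewrite mul_row_col UV mxE; apply: eq_bigr => i _; by rewrite mxE mulrC.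
under eq_bigr => x _.
  under eq_bigr => y _ do rewrite E.
  rewrite sum_chi_dot.
  over.
rewrite (bigD1 0) //= trmx0 eqxx mul1r big1 ?addr0; last first.
  move=> x /negPf x0; rewrite (_ : (x^T == 0) = false) ?mul0r //.
  by apply/negbTE/eqP => /(congr1 trmx); rewrite trmxK trmx0 => /eqP; rewrite x0.
rewrite -exprD => H; apply: (mulfI (expf_neq0 (l + l) (q_neq0 F))).
by rewrite -H -exprD; congr (_ ^+ _); lia.
Qed.

(** By orthogonality of characters, q times the number of isotropic vectors is
    q^m + (q - 1) G(B).  As G(B) > 0, this exceeds q times the size q^(m - 2l - 2)
    of the radical, so that not every isotropic vector is in the radical. *)
Lemma exists_isotropic m l (B : 'M[F]_m) : sesq 1 B -> \rank B = l.+1.*2 ->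
  gsum B = q ^+ (m - l.+1) -> exists2 x, qform B x = 0 & x *m B != 0.
Proof.
move=> sB rB gB; suff /existsP[x /andP[/eqP qx xB]] :
    [exists x, (qform B x == 0) && (x *m B != 0)] by exists x.
apply: contraT; rewrite negb_exists => /forallP none.
pose Z := #|[pred x : 'rV[F]_m | qform B x == 0]|.
have ZE : q * Z%:R = q ^+ m + (q - 1) * q ^+ (m - l.+1).
  transitivity (\sum_(c : F) \sum_(u : 'rV[F]_m) chi (c * qform B u)).
    rewrite exchange_big /=.
    rewrite (eq_bigr (fun u => (qform B u == 0)%:R * q)) => [|u _]; last first.
      have [->|u0] := eqVneq (qform B u) 0.
        rewrite (eq_bigr (fun _ => 1)) => [|c _]; last by rewrite mulr0.
        by rewrite sumr_const mul1r.
      rewrite mul0r -[RHS](sum_chi_scale u0).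
      by apply: eq_bigr => c _; rewrite mulrC.
    rewrite -mulr_suml mulrC; congr (_ * _).
    by rewrite -natr_sum -big_mkcond /= sum1_card.
  rewrite (bigD1 0) //=; congr (_ + _).
    rewrite (eq_bigr (fun _ => 1)) => [|u _]; last by rewrite mul0r.
    by rewrite sumr_const card_mx mul1n natrX.
  rewrite (eq_bigr (fun _ => q ^+ (m - l.+1))) => [|c c0].
    rewrite sumr_const -[LHS]mulr_natl; congr (_ * _).
    have : #|F| = (1 + #|[pred c : F | (c != 0)%R]|)%N.
      by rewrite -(cardC (pred1 (0 : F))) card1; congr addn; apply: eq_card.
    by move=> ->; rewrite natrD addrAC subrr add0r; congr _%:R; apply: eq_card.
  rewrite -gB -[RHS]mul1r -(_ : qchar c ^+ \rank B = 1); last first.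
    by rewrite rB -mul2n exprM expr2 qchar_sqr expr1n.
  rewrite -(gsum_scale sB c0); apply: eq_bigr => u _.
  by congr chi; rewrite /qform -scalemxAr -scalemxAl [RHS]mxE.
have le_lm : (l.+1.*2 <= m)%N by rewrite -rB rank_leq_row.
have q_gt1 : 1 < q by rewrite ltr1n finRing_gt1.
have q_gt0 : 0 < q by apply: lt_trans q_gt1.
have : q * Z%:R <= q ^+ m.
  apply: (@le_trans _ _ (q * q ^+ (m - \rank B))).
    rewrite ler_pM2l // -natrX -card_row_kernel ler_nat.
    apply/subset_leq_card/subsetP => x; rewrite !inE => qx.
    by have := none x; rewrite qx /= negbK.
  by rewrite -exprS ler_eXn2l // rB; lia.
rewrite ZE gerDl lt_geF //.
by rewrite mulr_gt0 ?subr_gt0 ?exprn_gt0.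
Qed.

Lemma hyperbolic_frame_cong m l (P B : 'M[F]_m) : P \in unitmx ->
  hyperbolic_frame l (P *m B *m P^T) -> hyperbolic_frame l B.
Proof.
move=> uP [U [V [span UV]]]; exists (U *m P), (V *m P); split=> [z|x y].
  have [x [y [w [zE wB]]]] := span (z *m invmx P).
  exists x, y, (w *m P); split.
    by rewrite !mulmxA -!mulmxDl -zE mulmxKV.
  have : w *m P *m B *m P^T = 0 by rewrite -wB !mulmxA.
  move/(congr1 (mulmx^~ (invmx P^T))); rewrite mul0mx mulmxK // ?unitmx_tr //.
rewrite -UV /qform !mulmxA -mulmxDl trmx_mul !mulmxA.
by rewrite !mulmxDl.
Qed.

Lemma hyperbolic_frame_hplus n l (B : 'M[F]_n) :
  hyperbolic_frame l B -> hyperbolic_frame l.+1 (hplus 1 B).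
Proof.
move=> [U [V [span UV]]].
pose U' : 'M[F]_(1 + l, 1 + (1 + n)) := block_mx 1%:M 0 0 (row_mx 0 U).
pose V' : 'M[F]_(1 + l, 1 + (1 + n)) :=
  block_mx 0 (row_mx 1%:M 0) 0 (row_mx 0 V).
have UV' a b (x y : 'rV[F]_l) :
    row_mx a%:M x *m U' + row_mx b%:M y *m V' =
    row_mx a%:M (row_mx b%:M (x *m U + y *m V)).
  rewrite !mul_row_block !mul_mx_row !(mulmx0, mulmx1, addr0, add0r) !add_row_mx.
  by rewrite !(addr0, add0r).
exists U', V'; split=> [z|x y].
  have [x [y [w [zE wB]]]] := span (rsubmx (rsubmx z)).
  exists (row_mx (lsubmx z) x), (row_mx (lsubmx (rsubmx z)) y).
  exists (row_mx 0 (row_mx 0 w)); split.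
    rewrite [lsubmx z]mx11_scalar [lsubmx (rsubmx z)]mx11_scalar UV' !add_row_mx !addr0.
    by rewrite -zE -!mx11_scalar !hsubmxK.
  have -> : (0 : 'M[F]_1) = 0%:M by rewrite raddf0.
  by rewrite hplus_mul wB !mulr0 raddf0 !row_mx0.
move: x y; rewrite -[l.+1]/(1 + l)%N => x y.
rewrite -[x]hsubmxK -[y]hsubmxK [lsubmx x]mx11_scalar [lsubmx y]mx11_scalar UV'.
rewrite qform_hplus // UV big_split_ord /= big_ord1 !row_mxEl !mxE !mulr1n.
by congr (_ + _); apply: eq_bigr => i _; rewrite !row_mxEr.
Qed.

(** A positive Gauss sum yields a hyperbolic plane by exists_isotropic, and the
    Gauss sum of the complement is again positive. *)
Lemma gsum_hyperbolic m l (B : 'M[F]_m) : sesq 1 B -> \rank B = l.*2 ->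
  gsum B = q ^+ (m - l) -> hyperbolic_frame l B.
Proof.
elim: l m B => [|l IH] m B sB rB gB.
  have /eqP := rB; rewrite mxrank_eq0 => /eqP ->; exists 0, 0; split=> [z|x y].
    by exists 0, 0, z; rewrite !mulmx0 !add0r.
  by rewrite big_ord0 /qform mulmx0 mul0mx mxE.
have [x qx xB] := exists_isotropic sB rB gB.
have := isotropic_dim one2 sB qx xB.
case: m B sB rB gB x qx xB => [|[|n]] // B sB rB gB x qx xB _.
have [P [B' [uP sB' PE]]] := @isotropic_split _ one2 n B x sB qx xB.
apply: (hyperbolic_frame_cong uP); rewrite PE; apply/hyperbolic_frame_hplus.
have rB' : \rank B' = l.*2.
  by have := rank_cong B uP; rewrite PE rank_hplus // rB => -[].
apply: IH => //; apply: (mulfI (q_neq0 F)).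
rewrite -(gsum_hplus) -PE (gsum_cong B uP) gB -exprS.
by congr (_ ^+ _); have := rank_leq_row B'; lia.
Qed.

(** The Gauss sum is plus or minus q^(m - l), and the sign is the type. *)
Lemma gsum_symm_type m l (B : 'M[F]_m) : sesq 1 B -> \rank B = l.*2 ->
  gsum B = (symm_type B)%:~R * q ^+ (m - l).
Proof.
move=> sB rB; rewrite /symm_type {1}rB odd_double; case: ifPn => hB.
  by rewrite mul1r; apply: gsum_hyperbolic_frame => //; apply/hyperbolicE.
case: (gsum_even_rank sB rB) => gB.
  by case/negP: hB; apply/(hyperbolicE rB)/gsum_hyperbolic.
by rewrite gB mulN1r.
Qed.

(** * Weights of the codewords *)

Lemma mem_symm m (A : 'M[F]_m) : (A \in symm F m) = sesq 1 A.
Proof.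
rewrite inE is_hermitianmxE expr0 scale1r map_mx_id //.
by rewrite /sesq scale1r eq_sym.
Qed.

Lemma skewmx_sesq m (A : 'M[F]_m) : (A \is skewmx) = sesq (-1) A.
Proof.
rewrite is_hermitianmxE expr1 map_mx_id // /sesq !scaleN1r.
by rewrite [LHS]eq_sym eqr_oppLR.
Qed.

(** A value x is zero or not according to whether the sum of chi (c x) over all
    scalars c is q or 0. *)
Lemma hamming_weight_cumsum a m (B : 'M[F]_m) : sesq 1 B ->
  q * (hamming_weight (codeword a B))%:R =
  (q - 1) * #|symm_le F a m|%:R - \sum_(c | c != 0) cumsum 1 a.+1 (c *: B).
Proof.
move=> sB; have memE A : (A \in symm_le F a m) = sesq 1 A && (\rank A < a.+1)%N.
  by rewrite inE mem_symm ltnS.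
have -> : (hamming_weight (codeword a B))%:R =
    \sum_(A in symm_le F a m) (\tr (B *m A) != 0)%:R :> algC.
  rewrite /hamming_weight -sum1_card natr_sum big_mkcond /= [RHS]big_enum_val.
  by apply: eq_bigr => i _; rewrite inE mxE; case: (_ == 0).
rewrite mulrBl mul1r -sum1_card natr_sum mulr_sumr mulr_sumr.
rewrite (eq_bigr (fun A => q - \sum_c chi (c * \tr (B *m A)))); last first.
  move=> A _; have [->|t0] := eqVneq (\tr (B *m A)) 0.
    rewrite mulr0 (eq_bigr (fun _ => 1)) ?sumr_const ?subrr // => c _.
    by rewrite mulr0.
  under eq_bigr do rewrite mulrC.
  by rewrite (sum_chi_scale t0) subr0 mulr1.
rewrite big_split /= sumrN exchange_big /= [\sum_(j | true) _](bigD1 0) //=.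
rewrite [in LHS]opprD addrA.
congr (_ - _ - _).
- by apply: eq_bigr => A _; rewrite mulr1.
- by apply: eq_bigr => A _; rewrite mul0r.
apply: eq_bigr => c _; apply: eq_big => A; first exact: memE.
move=> _; congr chi; rewrite -mxtraceZ scalemxAl; congr (\tr (_ *m _)).
by rewrite linearZ /= (eqP sB) scale1r.
Qed.

Lemma weight_odd_rank t m l (B : 'M[F]_m) : sesq 1 B -> \rank B = l.*2.+1 ->
  q * (hamming_weight (codeword (2 * t + 1) B))%:R =
  (q - 1) * #|symm_le F (2 * t + 1) m|%:R.
Proof.
move=> sB rB; rewrite hamming_weight_cumsum // big1 ?subr0 // => c c0.
apply: (cumsum_odd_rank (l := l)).
- by rewrite addn1 /= negbK mul2n odd_double.
- exact: sesq1_scale.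
- by rewrite mxrank_scale_nz.
Qed.

(** Scaling B by c does not change its Gauss sum, the rank being even, so the
    q - 1 scalars contribute equally. *)
Lemma weight_even_rank t m l (B C : 'M[F]_m) : sesq 1 B -> sesq (-1) C ->
  \rank B = l.*2 -> \rank C = l.*2 ->
  q * (hamming_weight (codeword (2 * t + 1) B))%:R =
  (q - 1) * (#|symm_le F (2 * t + 1) m|%:R -
    (symm_type B)%:~R * q ^+ (m - l) * cumsum (-1) (2 * t + 2) C).
Proof.
move=> sB sC rB rC; rewrite hamming_weight_cumsum // mulrBr; congr (_ - _).
rewrite (eq_bigr (fun _ => gsum B * cumsum (-1) (2 * t + 2) C)).
  rewrite sumr_const -(gsum_symm_type sB rB) -[LHS]mulr_natl.
  congr (_ * _); rewrite -[X in X%:R - 1](cardC (pred1 (0 : F))) card1 natrD.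
  rewrite addrAC subrr add0r.
  by congr _%:R; apply: eq_card.
move=> c c0; have -> : (2 * t + 1).+1 = (2 * t + 2)%N by lia.
rewrite (cumsum_symm_skew (l := l) (C := C)) //.
- rewrite (gsum_scale sB c0) rB -mul2n exprM expr2 qchar_sqr.
  by rewrite expr1n mul1r.
- by rewrite oddD mul2n odd_double.
- exact: sesq1_scale.
- by rewrite mxrank_scale_nz.
Qed.

Lemma exists_skew l m : (l.*2 <= m)%N ->
  exists2 C : 'M[F]_m, sesq (-1) C & \rank C = l.*2.
Proof.
elim: l m => [|l IH] m lm; first by exists 0; rewrite ?sesq0 ?mxrank0.
case: m lm => [|[|m]] // lm; have [C sC rC] := IH m lm.
by exists (hplus (-1) C); rewrite ?sesq_hplus // rank_hplus // rC.
Qed.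

Lemma exists_symm r m : (r <= m)%N -> exists2 B : 'M[F]_m, sesq 1 B & \rank B = r.
Proof.
move=> rm; exists (pid_mx r); last by rewrite rank_pid_mx.
by rewrite /sesq tr_pid_mx scale1r.
Qed.

(** Multiplying one diagonal entry by a nonsquare changes the sign of the Gauss
    sum, hence the type, so both types occur as soon as the rank is positive. *)
Lemma exists_symm_type l m (tau : int) : (0 < l)%N -> (l.*2 <= m)%N ->
  tau = 1 \/ tau = -1 ->
  exists B : 'M[F]_m, [/\ sesq 1 B, \rank B = l.*2 & symm_type B = tau].
Proof.
move=> l0 lm tau1; have [B sB rB] := exists_symm lm.
case: m lm B sB rB => [|n] lm B sB rB; first by lia.
have B0 : B != 0 by rewrite -mxrank_eq0 rB; lia.
have [P [b [B' [uP b0 sB' PE]]]] := @diagonal_split n B sB B0.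
have [c c0 cE] := qchar_nonsquare.
have rbB x : x != 0 -> \rank (border 1 x 0 B') = l.*2.
  move=> x0; rewrite border0_rank // x0 -rB -(rank_cong B uP) PE.
  by rewrite border0_rank // b0.
have sbB x : sesq 1 (border 1 x 0 B') by rewrite sesq_border // mul1r eqxx.
have G x : x != 0 -> gsum (border 1 x 0 B') =
    (symm_type (border 1 x 0 B'))%:~R * q ^+ (n.+1 - l).
  by move=> x0; apply: gsum_symm_type => //; apply: rbB.
have bc0 : b * c != 0 by rewrite mulf_neq0.
have := G _ bc0; rewrite gsum_border0 // gauss_scale // -mulrA -gsum_border0 // G // cE.
rewrite mulN1r -mulNr => /(mulIf (expf_neq0 _ (q_neq0 F))).
rewrite -mulrNz => /eqP; rewrite eqr_int => /eqP E.
have pm : symm_type (border 1 b 0 B') = 1 \/ symm_type (border 1 b 0 B') = -1.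
  by rewrite /symm_type rbB // odd_double; case: ifP; [left|right].
have [->|tN] := eqVneq tau (symm_type (border 1 b 0 B')).
  by exists (border 1 b 0 B'); split; rewrite ?rbB.
exists (border 1 (b * c) 0 B'); split; rewrite ?rbB //.
by rewrite -E; case: pm tau1 tN => -> [] ->.
Qed.

(** The trace pairs every entry above the diagonal with its mirror image, so the
    Krawtchouk pairing is half of it. *)
Lemma skew_trace_pairing m (A B : 'M[F]_m) : sesq (-1) A -> sesq (-1) B ->
  \tr ((2%:R^-1 *: A)^T *m B) = \sum_(i < m) \sum_(j < m | (i < j)%N) A i j * B i j.
Proof.
move=> sA sB.
have tr_low (M : 'M[F]_m) i j : sesq (-1) M -> M i j = - M j i.
  by move=> /eqP/matrixP/(_ j i); rewrite !mxE mulN1r.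
have diag i : A i i = 0.
  have := tr_low _ i i sA => /eqP; rewrite -addr_eq0 -mulr2n -mulr_natr mulf_eq0.
  by rewrite (negPf two_neq0) orbF => /eqP.
pose S := \sum_(i < m) \sum_(j < m | (i < j)%N) A i j * B i j.
have E : \tr (A^T *m B) = 2%:R * S.
  rewrite mulr_natl mulr2n /mxtrace.
  transitivity (\sum_i \sum_j A i j * B i j).
    rewrite exchange_big /=; apply: eq_bigr => i _; rewrite mxE.
    by apply: eq_bigr => j _; rewrite mxE.
  have -> : \sum_i \sum_j A i j * B i j =
      \sum_(i < m) (\sum_(j < m | (i < j)%N) A i j * B i j
                    + \sum_(j < m | (j < i)%N) A i j * B i j).
    apply: eq_bigr => i _; rewrite (bigID (fun j : 'I_m => (i < j)%N)) /=; congr (_ + _).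
    rewrite (bigID (fun j : 'I_m => (j < i)%N)) /= [X in _ + X]big1 ?addr0.
      by apply: eq_bigl => j; lia.
    move=> j ij; have -> : j = i by apply/val_inj => /=; lia.
    by rewrite diag mul0r.
  rewrite big_split /=; congr (_ + _).
  rewrite (exchange_big_dep xpredT) //=; apply: eq_bigr => i _; apply: eq_bigr => j _.
  by rewrite (tr_low A j i sA) (tr_low B j i sB) mulrNN.
by rewrite linearZ /= -scalemxAl mxtraceZ E mulKf.
Qed.

End Characters.
End OddField.

(** If 2 = 0, the element 1 has additive order 2, which would divide the order of
    the field. *)
Lemma two_neq0_odd (F : finFieldType) : odd #|F| -> 2%:R != 0 :> F.
Proof.
move=> Fodd; apply/negP => /eqP two0.
have o2 : (#[1%R : F]%g %| 2)%N by rewrite order_dvdn; apply/eqP.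
have oF : (#[1%R : F]%g %| #|F|)%N by rewrite -cardsT; apply: order_dvdG; rewrite inE.
have : (#[1%R : F]%g %| gcdn 2 #|F|)%N by rewrite dvdn_gcd o2.
rewrite (eqP (_ : coprime 2 #|F|)) ?coprime2n // dvdn1 order_eq1.
by apply/negP; apply: oner_neq0.
Qed.

Theorem theorem3p9 (F : finFieldType) (Fodd : odd #|F|)
    (chi : 'CF([set: F])) (chi_lin : chi \is a linear_char) (chi_nontriv : chi != 1)
    (m : nat) (m_gt0 : (0 < m)%N) (t : nat) (t_le : (t <= (m - 1)./2)%N) :
  let q : algC := #|F|%:R in
  let W (k : nat) (tau : int) : algC := (class_weight F (2 * t + 1) m k tau)%:R in
  [/\ forall B : 'M[F]_m, B \in symm F m -> B != 0 ->
        (hamming_weight (codeword (2 * t + 1) B))%:R = W (\rank B) (symm_type B),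
      forall l : nat, (2 * l + 1 <= m)%N ->
        symm_class F m (2 * l + 1) 0 != set0 /\
        W (2 * l + 1)%N 0 = (q - 1) / q * \sum_(0 <= r < (2 * t + 1).+1) (mu F r m)%:R
    & forall (l : nat) (tau : int), (1 <= l)%N -> (2 * l <= m)%N ->
        tau = 1 \/ tau = -1 ->
        symm_class F m (2 * l) tau != set0 /\
        forall A : 'M[F]_(m - 2), A \in Omega F (m - 2) (l - 1) ->
          W (2 * l)%N tau =
            W 1%N 0 - tau%:~R * ((q - 1) / q) * q ^+ (m - l + 2 * t)
                      * krawtchouk chi t A].
Proof.
move=> q W; have two_neq0 := two_neq0_odd Fodd.
have one2 : 1 * 1 = 1 :> F := mulr1 1.
have mone2 : (-1) * (-1) = 1 :> F by rewrite mulrNN mulr1.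
have chi0 : chi 0 = 1 by exact: lin_char1.
have chiD : {morph chi : x y / x + y >-> x * y}.
  by move=> x y; apply: (lin_charM chi_lin); rewrite inE.
have chiN1 : exists x, chi x != 1.
  apply/existsP; apply: contraNT chi_nontriv; rewrite negb_exists => /forallP h.
  by apply/eqP/cfunP => x; rewrite cfun1E inE; apply/eqP; rewrite -[_ == _]negbK.
have q0 : q != 0 := q_neq0 F.
have NE : #|symm_le F (2 * t + 1) m|%:R =
    \sum_(0 <= r < (2 * t + 1).+1) (mu F r m)%:R :> algC.
  rewrite -natr_sum; congr _%:R; rewrite -sum1_card.
  rewrite (partition_big
    (fun A : 'M[F]_m => inord (\rank A) : 'I_(2 * t + 1).+1) xpredT) //=.
  rewrite big_mkord; apply: eq_bigr => r _; rewrite /mu -sum1_card; apply: eq_bigl => A.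
  rewrite !inE; case: (_ \is _) => //=.
  case: leqP => rA /=; last by apply/esym/negbTE; have := ltn_ord r; lia.
  by rewrite -val_eqE /= inordK.
have classE k tau (B : 'M[F]_m) : (B \in symm_class F m k tau) =
    [&& sesq 1 B, \rank B == k & symm_type B == tau].
  by rewrite inE mem_symm.
have W_of k tau : symm_class F m k tau != set0 -> exists B : 'M[F]_m,
    [/\ sesq 1 B, \rank B = k, symm_type B = tau &
        W k tau = (hamming_weight (codeword (2 * t + 1) B))%:R].
  rewrite /W /class_weight => /set0Pn[B0 B0in]; case: pickP => [B|/(_ B0)];
    last by rewrite B0in.
  by rewrite classE => /and3P[sB /eqP rB /eqP tB]; exists B.
have odd_type k (B : 'M[F]_m) : \rank B = k -> odd k -> symm_type B = 0.
  by move=> rB ok; rewrite /symm_type rB ok.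
have oddW l : (2 * l + 1 <= m)%N -> symm_class F m (2 * l + 1) 0 != set0 /\
    W (2 * l + 1)%N 0 = (q - 1) / q * \sum_(0 <= r < (2 * t + 1).+1) (mu F r m)%:R.
  move=> lm; have ne : symm_class F m (2 * l + 1) 0 != set0.
    have [B sB rB] := exists_symm F lm; apply/set0Pn; exists B.
    by rewrite classE sB rB eqxx (odd_type _ _ rB) // addn1 /= mul2n odd_double.
  split=> //; have [B [sB rB _ ->]] := W_of _ _ ne.
  apply: (mulfI q0); rewrite mulrA mulrCA divff // mulr1 -NE.
  by apply: (weight_odd_rank two_neq0 chi0 chiD chiN1 t (l := l)) => //; rewrite rB; lia.
split=> //.
- move=> B; rewrite mem_symm => sB B0.
  have ne : symm_class F m (\rank B) (symm_type B) != set0.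
    by apply/set0Pn; exists B; rewrite classE sB !eqxx.
  have [B' [sB' rB' tB' ->]] := W_of _ _ ne; apply: (mulfI q0).
  have [] := boolP (odd (\rank B)) => oB.
    have rE : \rank B = (\rank B)./2.*2.+1 by rewrite -{1}[\rank B]odd_double_half oB.
    by rewrite !(weight_odd_rank two_neq0 chi0 chiD chiN1 t (l := (\rank B)./2)) // rB'.
  have rE : \rank B = (\rank B)./2.*2 by rewrite -{1}[\rank B]odd_double_half (negPf oB).
  have [C sC rC] : exists2 C : 'M[F]_m, sesq (-1) C & \rank C = (\rank B)./2.*2.
    by apply: exists_skew => //; rewrite -rE rank_leq_row.
  rewrite (weight_even_rank two_neq0 chi0 chiD chiN1 t sB sC rE rC).
  by rewrite (weight_even_rank two_neq0 chi0 chiD chiN1 t sB' sC (etrans rB' rE) rC) tB'.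
move=> l tau l0 lm tau1; have ne : symm_class F m (2 * l) tau != set0.
  rewrite mul2n in lm *.
  have [B [sB rB tB]] := exists_symm_type two_neq0 chi0 chiD chiN1 l0 lm tau1.
  by apply/set0Pn; exists B; rewrite classE sB rB tB !eqxx.
split=> // A; have [B [sB rB tB ->]] := W_of _ _ ne.
have [_] := oddW 0%N m_gt0; rewrite muln0 add0n => ->; rewrite -NE.
case: m m_gt0 t_le lm W NE classE W_of odd_type oddW B sB rB tB A ne =>
  [|[|n]] // _ _ lm W NE classE W_of odd_type oddW B sB rB tB A _; first by lia.
move: A; rewrite subSS subSS subn0 => A; rewrite inE skewmx_sesq => /andP[sA /eqP rA].
(* The halved representative converts the pairing over i < j into a trace, and
   a plane added to it gives a matrix of size m and rank 2l. *)
have sA2 : sesq (-1) (2%:R^-1 *: A).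
  by rewrite /sesq linearZ /= (eqP sA) !scalerA mulrC.
have rA2 : \rank (2%:R^-1 *: A) = (l - 1).*2 by rewrite mxrank_scale_nz ?invr_eq0.
have kE : krawtchouk chi t A = ranksum chi (-1) (2 * t) (2%:R^-1 *: A).
  rewrite /krawtchouk /ranksum; apply: eq_big => D.
    by rewrite inE skewmx_sesq mul2n.
  by rewrite inE skewmx_sesq => /andP[sD _]; rewrite skew_trace_pairing.
have rC : \rank (hplus (-1) (2%:R^-1 *: A)) = l.*2 by rewrite rank_hplus // rA2; lia.
have rB2 : \rank B = l.*2 by rewrite rB mul2n.
apply: (mulfI q0).
rewrite (weight_even_rank two_neq0 chi0 chiD chiN1 t sB (sesq_hplus mone2 sA2) rB2 rC).
rewrite addn2 (cumsum_hplus_skew two_neq0 chi0 chiD chiN1) // ?mul2n ?odd_double //.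
rewrite kE tB -/q exprD mul2n; field.
exact: q0.
Qed.
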